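(* Let $F:\mathbb{R}^p\times\mathbb{R}^m\to\mathbb{R}^p$ be continuous and semialgebraic with a Lipschitz gradient selection, and let $J_F=J_F^s$ be the associated selection conservative Jacobian. Assume there exists $0\le\rho<1$ such that for every $(x,\theta)\in\mathbb{R}^p\times\mathbb{R}^m$ and every $[A,B]\in J_F^s(x,\theta)$, with $A\in\mathbb{R}^{p\times p}$ and $B\in\mathbb{R}^{p\times m}$, one has $\|A\|_{\mathrm{op}}\le\rho$. Let $x_0:\mathbb{R}^m\to\mathbb{R}^p$ be Lipschitz and path differentiable with conservative Jacobian $J_{x_0}:\mathbb{R}^m\rightrightarrows\mathbb{R}^{p\times m}$. Define, for $k\in\mathbb{N}$ and $\theta\in\mathbb{R}^m$, $x_{k+1}(\theta)=F(x_k(\theta),\theta)$ and $$J_{x_{k+1}}(\theta)=\{AJ+B:\ [A,B]\in J^s_F(x_k(\theta),\theta),\ J\in J_{x_k}(\theta)\}.$$ Let $\bar x(\theta)$ be the unique fixed point of $F(\cdot,\theta)$ and $J^{\mathrm{pb}}_{\bar x}(\theta)=\mathrm{fix}[J_F^s(\bar x(\theta),\theta)]$. Then for any $\theta\in\mathbb{R}^m$ and any $\epsilon>0$ there exists $C>0$ such that $$\mathrm{gap}\left(J_{x_k}(\theta),J^{\mathrm{pb}}_{\bar x}(\theta)\right)\le C(\sqrt{\rho}+\epsilon)^k\qquad\forall k\in\mathbb{N}.$$ Moreover, for almost all $\theta\in\mathbb{R}^m$, the classical Jacobians $\frac{\partial}{\partial\theta}x_k(\theta)$ (which exist for all $k$)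 converge to $\frac{\partial}{\partial\theta}\bar x(\theta)$ at a linear (geometric) rate.
   Context: Lipschitz gradient selection: a continuous semialgebraic $F:\mathbb{R}^n\to\mathbb{R}^q$ has a Lipschitz gradient selection $(s,F_1,\dots,F_N)$ if $s:\mathbb{R}^n\to\{1,\dots,N\}$ is semialgebraic and there is $L\ge0$ such that each $F_i:\mathbb{R}^n\to\mathbb{R}^q$ is semialgebraic with $L$-Lipschitz Jacobian, and $F(z)=F_{s(z)}(z)$ for all $z\in\mathbb{R}^n$. With $I(z)=\{i\in\{1,\dots,N\}:F(z)=F_i(z)\}$, set $J_F^s(z)=\mathrm{conv}\left\{\frac{\partial F_i}{\partial z}(z):i\in I(z)\right\}\subset\mathbb{R}^{q\times n}$; it is known that $J_F^s$ is a conservative Jacobian for $F$. In the claim, $n=p+m$, $z=(x,\theta)$, $q=p$. Conservative Jacobian: for a locally Lipschitz $f:\mathbb{R}^n\to\mathbb{R}^q$, a set-valued map $J:\mathbb{R}^n\rightrightarrows\mathbb{R}^{q\times n}$ is a conservative Jacobian for $f$ if it has closed graph, is locally bounded, is nowhere empty, and for every absolutely continuous $\gamma:[0,1]\to\mathbb{R}^n$, for almost every $t\in[0,1]$, $\frac{d}{dt}f(\gamma(t))=V\dot\gamma(t)$ for all $V\in J(\gamma(t))$. $f$ is path differentiable if it admits a conservative Jacobian. $[A,B]$ is the concatenation of $A$ and $B$; $\|\cdot\|_{\mathrm{op}}$ is the operator norm induced by the Euclidean norm. The contraction hypothesis implies that $F(\cdot,\theta)$ is a strict contraction, so it has a unique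 fixed point. Set-valued fixed point: if $\mathcal{J}\subset\mathbb{R}^{p\times(p+m)}$ is nonempty, compact, and every $[A,B]\in\mathcal{J}$ has $\|A\|_{\mathrm{op}}\le\rho<1$, then $\mathrm{fix}(\mathcal{J})$ denotes the unique nonempty compact set $\mathcal{X}\subset\mathbb{R}^{p\times m}$ with $\mathcal{X}=\{AX+B:[A,B]\in\mathcal{J},X\in\mathcal{X}\}$. For nonempty compact sets $\mathcal{X},\mathcal{Y}$ of matrices, $\mathrm{gap}(\mathcal{X},\mathcal{Y})=\max_{X\in\mathcal{X}}\min_{Y\in\mathcal{Y}}\|X-Y\|$ with the Euclidean (Frobenius) norm. Linear rate: for some $C>0$ and $r\in(0,1)$ (depending on $\theta$), the error at step $k$ is at most $Cr^k$. *)

(* Defs.v *)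
From HB Require Import structures.
From mathcomp Require Import all_boot all_order all_algebra.
From mathcomp Require Import all_classical all_reals all_analysis.
(* Not imported: its notations clash with those of the analysis library. *)
From mathcomp.multinomials Require mpoly.

Set Implicit Arguments.
Unset Strict Implicit.
Unset Printing Implicit Defensive.

Import Order.TTheory GRing.Theory Num.Theory.
Import numFieldNormedType.Exports.

Local Open Scope classical_set_scope.
Local Open Scope ring_scope.

(* R^n is 'cV[R]_n, so that q x n Jacobians act by left multiplication; the
   point (x, theta) is col_mx x theta and [A, B] is row_mx A B.  The library
   norm on matrices is the sup norm: it is used only for the topology, for
   differentiability and for the existence of a Lipschitz constant, none of
   which depends on the choice of a norm. *)

Section Norms.
Variable R : realType.

Definition frobenius_norm (q n : nat) (A : 'M[R]_(q, n)) : R :=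
  Num.sqrt (\sum_(i < q) \sum_(j < n) A i j ^+ 2).

Definition operator_norm (q n : nat) (A : 'M[R]_(q, n)) : R :=
  sup [set frobenius_norm (A *m v) | v in
        [set v : 'cV[R]_n | frobenius_norm v <= 1]].

(* Extended-real valued, hence without junk values; on nonempty compact sets
   the supremum and the infimum are the max and the min. *)
Definition gap (q n : nat) (X Y : set 'M[R]_(q, n)) : \bar R :=
  ereal_sup [set ereal_inf [set (frobenius_norm (A - B))%:E | B in Y] | A in X].

End Norms.

Section Semialgebraic.
Variable R : realType.

(* A finite union, indexed by c, of sets
   {x | f(x) = 0 for all f in b.1, g(x) > 0 for all g in b.2}. *)
Definition semialgebraic_set (n : nat) (A : set 'cV[R]_n) : Prop :=
  exists c : seq (seq (mpoly.mpoly n R) * seq (mpoly.mpoly n R)),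
    forall x : 'cV[R]_n, A x <->
      has (fun b => all (fun f => mpoly.meval (fun i => x i 0) f == 0) b.1 &&
                    all (fun g => 0 < mpoly.meval (fun i => x i 0) g) b.2) c.

Definition semialgebraic_map (n q : nat) (f : 'cV[R]_n -> 'cV[R]_q) : Prop :=
  semialgebraic_set [set w : 'cV[R]_(n + q) | dsubmx w = f (usubmx w)].

(* The values 0, ..., N-1 of s : R^n -> 'I_N stand for the reals 1, ..., N. *)
Definition semialgebraic_index (n N : nat) (s : 'cV[R]_n -> 'I_N) : Prop :=
  semialgebraic_map (fun z => const_mx (s z).+1%:R : 'cV[R]_1).

End Semialgebraic.

Section Jacobians.
Variable R : realType.

(* The library's [jacobian] is the transpose, for functions on row vectors. *)
Definition Jac (n q : nat) (f : 'cV[R]_n -> 'cV[R]_q) (z : 'cV[R]_n) :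
    'M[R]_(q, n) :=
  \matrix_(i, j) ('d f z (delta_mx j 0 : 'cV[R]_n) : 'cV[R]_q) i 0.

Definition lipschitz_gradient_selection (n q N : nat)
    (F : 'cV[R]_n -> 'cV[R]_q) (s : 'cV[R]_n -> 'I_N)
    (Fs : 'I_N -> 'cV[R]_n -> 'cV[R]_q) : Prop :=
  [/\ semialgebraic_index s,
      (exists L : R, 0 <= L /\ forall i : 'I_N,
        [/\ semialgebraic_map (Fs i),
            (forall z, differentiable (Fs i) z) &
            forall z z', frobenius_norm (Jac (Fs i) z - Jac (Fs i) z') <=
                         L * frobenius_norm (z - z')]) &
      forall z, F z = Fs (s z) z].

Definition convex_hull (V : lmodType R) (A : set V) : set V :=
  smallest (@convex_set R V) A.

Definition selection_jacobian (n q N : nat) (F : 'cV[R]_n -> 'cV[R]_q)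
    (Fs : 'I_N -> 'cV[R]_n -> 'cV[R]_q) (z : 'cV[R]_n) : set 'M[R]_(q, n) :=
  convex_hull [set Jac (Fs i) z | i in [set i | F z = Fs i z]].

(* Absolute continuity on [0, 1]; only the restriction of g to it matters. *)
Definition absolutely_continuous01 (n : nat) (g : R -> 'cV[R]_n) : Prop :=
  forall e : R, 0 < e -> exists2 d : R, 0 < d &
    forall (k : nat) (a b : 'I_k -> R),
      (forall i, 0 <= a i /\ a i <= b i /\ b i <= 1) ->
      trivIset setT (fun i => `]a i, b i[%classic) ->
      \sum_i (b i - a i) < d ->
      \sum_i frobenius_norm (g (b i) - g (a i)) < e.

Definition conservative_jacobian (n q : nat) (f : 'cV[R]_n -> 'cV[R]_q)
    (J : 'cV[R]_n -> set 'M[R]_(q, n)) : Prop :=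
  [/\ closed [set zV : 'cV[R]_n * 'M[R]_(q, n) | J zV.1 zV.2],
      (forall z : 'cV[R]_n, exists M : R, \forall y \near z,
        forall V, J y V -> frobenius_norm V <= M),
      (forall z, J z !=set0) &
      forall g : R -> 'cV[R]_n, absolutely_continuous01 g ->
        {ae lebesgue_measure, forall t : R, t \in `[0, 1] ->
          [/\ derivable g t 1, derivable (f \o g) t 1 &
              forall V, J (g t) V -> derive1 (f \o g) t = V *m derive1 g t]}].

End Jacobians.

Section FixedPoints.
Variable R : realType.

Definition affine_image (p m : nat) (J : set 'M[R]_(p, p + m))
    (X : set 'M[R]_(p, m)) : set 'M[R]_(p, m) :=
  [set W | exists (A : 'M[R]_p) (B Y : 'M[R]_(p, m)),
     [/\ J (row_mx A B), X Y & W = A *m Y + B]].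

(* [get] selects an element of a set, and is arbitrary if the set is empty:
   here, the unique nonempty compact X with X = {A X + B}. *)
Definition fix_set (p m : nat) (J : set 'M[R]_(p, p + m)) :
    set 'M[R]_(p, m) :=
  get [set X | [/\ X !=set0, compact X & X = affine_image J X]].

Definition fixed_point (p m : nat) (F : 'cV[R]_(p + m) -> 'cV[R]_p)
    (theta : 'cV[R]_m) : 'cV[R]_p :=
  get [set x | F (col_mx x theta) = x].

Fixpoint iterate (p m : nat) (F : 'cV[R]_(p + m) -> 'cV[R]_p)
    (x0 : 'cV[R]_m -> 'cV[R]_p) (k : nat) (theta : 'cV[R]_m) : 'cV[R]_p :=
  if k is k'.+1 then F (col_mx (iterate F x0 k' theta) theta) else x0 theta.

Fixpoint iterate_jacobian (p m : nat) (F : 'cV[R]_(p + m) -> 'cV[R]_p)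
    (JF : 'cV[R]_(p + m) -> set 'M[R]_(p, p + m))
    (x0 : 'cV[R]_m -> 'cV[R]_p) (J0 : 'cV[R]_m -> set 'M[R]_(p, m))
    (k : nat) (theta : 'cV[R]_m) : set 'M[R]_(p, m) :=
  if k is k'.+1 then
    affine_image (JF (col_mx (iterate F x0 k' theta) theta))
                 (iterate_jacobian F JF x0 J0 k' theta)
  else J0 theta.

End FixedPoints.

Section AlmostEverywhere.
Variable R : realType.

(* Lebesgue-null subsets of R^n, the library having no Lebesgue measure on R^n:
   countable covers by closed boxes of arbitrarily small total volume.  The
   index set D allows the empty cover, which matters when n = 0. *)
Definition lebesgue_null (n : nat) (A : set 'cV[R]_n) : Prop :=
  forall e : R, 0 < e ->
    exists (D : set nat) (a b : nat -> 'cV[R]_n),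
      [/\ (forall k i, a k i 0 <= b k i 0),
          A `<=` \bigcup_(k in D)
            [set x | forall i, a k i 0 <= x i 0 /\ x i 0 <= b k i 0] &
          (\esum_(k in D) (\prod_(i < n) (b k i 0 - a k i 0))%:E <= e%:E)%E].

Definition almost_all (n : nat) (P : 'cV[R]_n -> Prop) : Prop :=
  lebesgue_null [set x | ~ P x].

End AlmostEverywhere.

(* Main.v *)
Require Import Defs.
From mathcomp Require Import all_boot all_order all_algebra.
From mathcomp Require Import all_classical all_reals all_analysis.
From mathcomp Require Import measurable_realfun ring lra.

(** At almost every theta each map theta' |-> F (z theta') that occurs is, on the
    closed set where it coincides with the C^1 branch F_i (z theta'), a composition
    with a C^1 map.  Almost every point x of an arbitrary set S is nonporous: the
    distance from x + h to S is o(|h|).  Hence, at almost every point, a locally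
    Lipschitz map inherits the derivative of any map it coincides with on S.  So
    no chain rule for conservative Jacobians is needed: a.e. the iterates and the
    fixed point are differentiable, and D x_(k+1) = A D x_k + B and
    D xbar = A D xbar + B for every active branch [A, B].

    Nonporosity reduces, one coordinate at a time, to the Lebesgue density theorem
    on lines.  Rademacher's theorem for x0 follows by walking along the axes: the
    conservative Jacobian supplies the partial derivatives almost everywhere on
    lines, and nonporosity allows a detour through points where they are uniform.
    Both use the same form of Fubini: a G_delta set with null sections in one
    coordinate direction is null.

    For the rates, the branches active at z_k are active at the limit zbar for
    large k, so each [A, B] in J(z_k) is within L |z_k - zbar| = O(rho^k) of
    J(zbar); the errors then satisfy e_(k+1) <= rho e_k + O(rho^k), which gives
    the rate q^k for every q > rho. *)

Set Implicit Arguments.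
Unset Strict Implicit.
Unset Printing Implicit Defensive.

Import Order.TTheory GRing.Theory Num.Theory.
Import numFieldNormedType.Exports.

Local Open Scope classical_set_scope.
Local Open Scope ring_scope.

(** * Null sets and dyadic cells *)

Section MatrixNorm.
Variable R : realType.

Lemma mx_norm_leP m n (A : 'M[R]_(m, n)) (c : R) : 0 <= c ->
  `|A| <= c <-> forall i j, `|A i j| <= c.
Proof.
move=> c0; rewrite [`|A|]/Num.norm/= mx_normrE; split=> [/bigmax_leP[_ H] i j|H].
  exact: (H (i, j)).
by apply/bigmax_leP; split=> // -[i j] _ /=.
Qed.

Lemma mx_norm_entry m n (A : 'M[R]_(m, n)) i j : `|A i j| <= `|A|.
Proof. by have /mx_norm_leP := lexx `|A|; apply. Qed.

Lemma lipschitz_continuous (V W : normedModType R) (f : V -> W) (c : R) :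
  (forall x y, `|f x - f y| <= c * `|x - y|) -> continuous f.
Proof.
move=> fc x U /nbhs_ballP[e /= e0 eU].
have c0 : 0 < `|c| + 1 by rewrite ltr_wpDl.
apply/nbhs_ballP; exists (e / (`|c| + 1)); first by rewrite /= divr_gt0.
move=> y; rewrite -ball_normE/= ltr_pdivlMr// mulrC => xy; apply: eU.
rewrite -ball_normE/=; apply: le_lt_trans (fc x y) (le_lt_trans _ xy).
by rewrite ler_wpM2r//; apply: le_trans (ler_norm c) _; rewrite lerDl.
Qed.

End MatrixNorm.

Section Null.
Variable R : realType.

(** A cover indexed by any countable type is reindexed by [nat] through [pickle], so that a union of
    countably many covers may be indexed by pairs. *)
Lemma lebesgue_null_cover (T : countType) n (A : set 'cV[R]_n) :
  (forall e : R, 0 < e -> exists (D : set T) (a b : T -> 'cV[R]_n),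
      [/\ (forall k i, a k i 0 <= b k i 0),
          A `<=` \bigcup_(k in D)
            [set x | forall i, a k i 0 <= x i 0 /\ x i 0 <= b k i 0] &
          (\esum_(k in D) (\prod_(i < n) (b k i 0 - a k i 0))%:E <= e%:E)%E]) ->
  lebesgue_null A.
Proof.
move=> H e /H[D [a [b [ab AD Dle]]]].
(* Codes that decode to nothing get the degenerate box at 0, which keeps the endpoints ordered for
   every index. *)
pose f (c : T -> 'cV[R]_n) k := oapp c 0 (unpickle k).
have fE c t : f c (pickle t) = c t by rewrite /f pickleK.
exists (pickle @` D), (f a), (f b); split.
- by move=> k i; rewrite /f; case: unpickle => //=; rewrite mxE.
- move=> x /AD[t Dt xt]; exists (pickle t); first by exists t.
  by rewrite /= !fE.
- rewrite esum_image; last by move=> x y _ _; exact: (pcan_inj pickleK).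
  by under eq_esum => t _ do rewrite !fE.
Qed.

Lemma lebesgue_nullS n (A B : set 'cV[R]_n) :
  A `<=` B -> lebesgue_null B -> lebesgue_null A.
Proof.
move=> AB B0 e /B0[D [a [b [ab BD De]]]]; exists D, a, b; split => //.
exact: subset_trans BD.
Qed.

Lemma lebesgue_null0 n : lebesgue_null (set0 : set 'cV[R]_n).
Proof.
move=> e e0; exists set0, (fun=> 0), (fun=> 0); split => //.
by rewrite esum_set0 lee_fin ltW.
Qed.

Lemma lebesgue_null_bigcup (T : countType) n (A : T -> set 'cV[R]_n) :
  (forall t, lebesgue_null (A t)) -> lebesgue_null (\bigcup_t A t).
Proof.
move=> A0; apply: (@lebesgue_null_cover (T * nat)%type) => e e0.
have e'0 (t : T) : 0 < e / (2 ^ (pickle t).+1)%:R :> R.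
  by rewrite divr_gt0// ltr0n expn_gt0.
have /choice[D /choice[a /choice[b H]]] := fun t : T => A0 t _ (e'0 t).
exists [set tk | D tk.1 tk.2], (fun tk => a tk.1 tk.2), (fun tk => b tk.1 tk.2).
split.
- by move=> [t k] i; have [+ _ _] := H t; exact.
- move=> x [t _ Atx]; have [_ /(_ _ Atx)[k Dk xk] _] := H t.
  by exists (t, k).
- have vge0 t k : (0 <= (\prod_(i < n) (b t k i 0 - a t k i 0))%:E)%E.
    by rewrite lee_fin prodr_ge0// => i _; have [+ _ _] := H t; rewrite subr_ge0.
  have -> : [set tk | D tk.1 tk.2] = [set: T] `*`` D.
    by apply/seteqP; split => [[t k]/= //|[t k] []].
  rewrite -(@esum_esum R T nat setT D
    (fun t k => (\prod_(i < n) (b t k i 0 - a t k i 0))%:E))//.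
  apply: (@le_trans _ _ (\esum_(t in [set: T]) (e / (2 ^ (pickle t).+1)%:R)%:E)%E).
    by apply: le_esum => t _; have [] := H t.
  rewrite -(@esum_image R T nat setT pickle (fun k => (e / (2 ^ k.+1)%:R)%:E));
    last by move=> x y _ _; exact: (pcan_inj pickleK).
  apply: le_trans (epsilon_trick0 xpredT (ltW e0)).
  have ek k : (0 <= (e / (2 ^ k.+1)%:R)%:E)%E by rewrite lee_fin divr_ge0// ltW.
  rewrite nneseries_esumT// esum_mkcond; apply: le_esum => // k _.
  by case: ifP.
Qed.

Lemma almost_allW n (P Q : 'cV[R]_n -> Prop) :
  (forall x, P x -> Q x) -> almost_all P -> almost_all Q.
Proof. by move=> PQ; apply: lebesgue_nullS => x /= nQ /PQ. Qed.

Lemma almost_all_forall (T : countType) n (P : T -> 'cV[R]_n -> Prop) :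
  (forall t, almost_all (P t)) -> almost_all (fun x => forall t, P t x).
Proof.
move=> H; apply: lebesgue_nullS (lebesgue_null_bigcup H) => x /= /existsNP[t].
by exists t.
Qed.

Lemma almost_allI n (P Q : 'cV[R]_n -> Prop) :
  almost_all P -> almost_all Q -> almost_all (fun x => P x /\ Q x).
Proof.
move=> aP aQ; have H : forall b : bool, almost_all (if b then P else Q) by case.
apply: almost_allW (almost_all_forall H) => x Hx.
by split; [exact: (Hx true)|exact: (Hx false)].
Qed.

Lemma almost_allT n (P : 'cV[R]_n -> Prop) : (forall x, P x) -> almost_all P.
Proof. by move=> PT; apply: lebesgue_nullS (@lebesgue_null0 n) => x /=; exact. Qed.

End Null.

Section Dyadic.
Variable R : realType.

Definition dyadic_cell m (n : nat) (k : {ffun 'I_m -> int}) : set 'cV[R]_m :=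
  [set x | forall i, Num.floor (2 ^+ n * x i 0) = k i].

Definition dyadic_index m (n : nat) (x : 'cV[R]_m) : {ffun 'I_m -> int} :=
  [ffun i => Num.floor (2 ^+ n * x i 0)].

Lemma dyadic_cellP m n k (x : 'cV[R]_m) :
  dyadic_cell n k x <-> k = dyadic_index n x.
Proof.
by split=> [H|-> i]; [apply/ffunP => i; rewrite ffunE H|rewrite ffunE].
Qed.

(** An integer [k] is at most [2 ^+ n' * u] iff the integer [2 ^+ (n - n') * k] is at most
    [2 ^+ n * u]; hence the finer floor determines the coarser one. *)
Lemma dyadic_index_nested m n n' (x y : 'cV[R]_m) : (n' <= n)%N ->
  dyadic_index n x = dyadic_index n y -> dyadic_index n' x = dyadic_index n' y.
Proof.
move=> nn' /ffunP xy; apply/ffunP => i; move: (xy i); rewrite !ffunE => {}xy.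
have sub (u v : R) : Num.floor (2 ^+ n * u) = Num.floor (2 ^+ n * v) ->
    Num.floor (2 ^+ n' * u) <= Num.floor (2 ^+ n' * v).
  move=> uv; rewrite floor_ge_int.
  rewrite -(ler_pM2l (x := 2 ^+ (n - n')))// ?exprn_gt0// mulrA -exprD subnK//.
  have -> : 2 ^+ (n - n') * (Num.floor (2 ^+ n' * u))%:~R =
      (2 ^+ (n - n') * Num.floor (2 ^+ n' * u))%:~R :> R.
    by rewrite intrM rmorphXn.
  rewrite -floor_ge_int -uv floor_ge_int intrM rmorphXn/=.
  by rewrite -{2}(subnK nn') exprD -mulrA ler_pM2l ?exprn_gt0// floor_le.
by apply/eqP; rewrite eq_le !sub.
Qed.

Lemma dyadic_cell_dist m n k (x y : 'cV[R]_m) :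
  dyadic_cell n k x -> dyadic_cell n k y -> `|x - y| <= 2^-1 ^+ n.
Proof.
move=> kx ky; apply/mx_norm_leP => [|i j]; first exact: exprn_ge0.
rewrite ord1 !mxE -(ler_pM2l (x := 2 ^+ n)) ?exprn_gt0//.
rewrite -exprMn mulfV// expr1n -[X in X * _]ger0_norm ?exprn_ge0// -normrM mulrBr.
have /andP[x1 x2] := floor_itv (2 ^+ n * x i 0).
have /andP[y1 y2] := floor_itv (2 ^+ n * y i 0).
rewrite (kx i) in x1 x2; rewrite (ky i) in y1 y2.
rewrite intrD in x2 y2.
by rewrite ler_norml; lra.
Qed.

(* mu is the pullback of the Lebesgue measure of R^m along phi, tested on
   dyadic cells; this replaces the product measure on the type of columns. *)
Definition dyadic_chart m d (T : measurableType d) (mu : set T -> \bar R)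
    (phi : T -> 'cV[R]_m) : Prop :=
  forall n k, measurable (phi @^-1` dyadic_cell n k) /\
              mu (phi @^-1` dyadic_cell n k) = ((2^-1 ^+ n) ^+ m)%:E.

(** Makes an arbitrary direction [j] the real factor of a product, so that the sections in Fubini's
    theorem are lines parallel to the [j]-th axis. *)
Definition insert_coord m (T : Type) (phi : T -> 'cV[R]_m) (j : 'I_m.+1)
    (ty : R * T) : 'cV[R]_m.+1 :=
  \col_i oapp (fun i' => phi ty.2 i' 0) ty.1 (unlift j i).

Lemma floor_itvE (n : nat) (k : int) :
  [set t : R | Num.floor (2 ^+ n * t) = k] =
  [set` `[2^-1 ^+ n * k%:~R, 2^-1 ^+ n * k%:~R + 2^-1 ^+ n[ ].
Proof.
have n0 : 0 < 2 ^+ n :> R by rewrite exprn_gt0.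
have E (z : R) : 2 ^+ n * (2^-1 ^+ n * z) = z.
  by rewrite mulrA -exprMn mulfV// expr1n mul1r.
apply/seteqP; split => t /=; rewrite in_itv/=.
  move=> <-; have /andP[t1 t2] := floor_itv (2 ^+ n * t).
  rewrite -(ler_pM2l n0) E t1/= -(ltr_pM2l n0) mulrDr E.
  by rewrite -[X in _ + _ * X]mulr1 E -(intrD _ _ 1).
move=> /andP[]; rewrite -(ler_pM2l n0) E => t1.
rewrite -(ltr_pM2l n0) mulrDr E -[X in _ + _ * X]mulr1 E -(intrD _ _ 1) => t2.
by apply: floor_def; rewrite t1.
Qed.

Lemma dyadic_chart_insert m d (T : measurableType d)
    (mu : {measure set T -> \bar R}) (phi : T -> 'cV[R]_m) (j : 'I_m.+1) :
  dyadic_chart mu phi ->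
  dyadic_chart (lebesgue_measure \x^ mu)%E
    (insert_coord phi j : measurableTypeR R * T -> _).
Proof.
move=> H n k; pose k' : {ffun 'I_m -> int} := [ffun i => k (lift j i)].
have -> : insert_coord phi j @^-1` dyadic_cell n k =
    [set t : R | Num.floor (2 ^+ n * t) = k j] `*` (phi @^-1` dyadic_cell n k').
  apply/seteqP; split => [[t y] /= kty|[t y] [/= kt ky] i].
    split => [|i /=]; first by rewrite -(kty j) mxE unlift_none.
    by rewrite ffunE -(kty (lift j i)) mxE liftK.
  rewrite mxE; case: unliftP => [i' ->|->] //=.
  by rewrite ky ffunE.
have [mk muk] := H n k'.
rewrite floor_itvE; set I := [set` _].
have mI : measurable (I : set (measurableTypeR R)) by exact: measurable_itv.
split; first exact: measurableX.
have I2 : lebesgue_measure I = (2^-1 ^+ n)%:E.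
  rewrite /I lebesgue_measure_itv/= lte_fin ltrDl exprn_gt0//.
  by rewrite -EFinD addrAC subrr add0r.
by rewrite product_measure2E// muk exprS EFinM; congr (_ * _)%E.
Qed.

(** A Dirac mass in dimension 0, then one Lebesgue factor for each coordinate. *)
Lemma dyadic_chart_exists m : exists d (T : measurableType d)
    (mu : {measure set T -> \bar R}) (phi : T -> 'cV[R]_m), dyadic_chart mu phi.
Proof.
elim: m => [|m [d [T [mu [phi H]]]]].
  exists _, unit, (dirac tt : {measure set unit -> \bar R}), (fun=> 0) => n k.
  split=> //.
  by rewrite expr0 /= diracE mem_set//= => -[].
exists _, _, (lebesgue_measure \x^ mu)%E, (insert_coord phi ord0).
exact: dyadic_chart_insert.
Qed.

End Dyadic.

(** * Fubini for G_delta sets *)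

Section Fubini.
Variable R : realType.

(** Openness for the topology generated by the dyadic cells. It covers the usual open sets as well
    as the half-open cells, and every such set splits into disjoint cells. *)
Definition dyadic_open m (U : set 'cV[R]_m) : Prop :=
  forall x, U x -> exists n, dyadic_cell n (dyadic_index n x) `<=` U.

Lemma open_dyadic_open m (U : set 'cV[R]_m) : open U -> dyadic_open U.
Proof.
move=> Uo x Ux; have /nbhs_ballP[e /= e0 eU] : nbhs x U by exact: open_nbhs_nbhs.
have [n _ ne] : \forall n \near \oo, (2^-1 : R) ^+ n < e.
  have : (2^-1 : R) ^+ n @[n --> \oo] --> (0 : R).
    by apply: cvg_expr; rewrite ger0_norm// invf_lt1// ltr1n.
  move=> /cvgrPdist_lt/(_ _ e0); apply: filterS => n.
  by rewrite sub0r normrN ger0_norm// exprn_ge0.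
exists n => y xy; apply: eU; rewrite -ball_normE/=.
apply: le_lt_trans (ne n (leqnn n)).
by apply: dyadic_cell_dist xy; exact/dyadic_cellP.
Qed.

Lemma dyadic_openI m (U V : set 'cV[R]_m) :
  dyadic_open U -> dyadic_open V -> dyadic_open (U `&` V).
Proof.
move=> oU oV x [/oU[n nU] /oV[n' nV]]; exists (maxn n n') => y /dyadic_cellP xy.
split.
- by apply/nU/dyadic_cellP/(dyadic_index_nested _ xy)/leq_maxl.
- by apply/nV/dyadic_cellP/(dyadic_index_nested _ xy)/leq_maxr.
Qed.

Lemma dyadic_open_cell m n k : dyadic_open (dyadic_cell n k : set 'cV[R]_m).
Proof. by move=> x /dyadic_cellP->; exists n. Qed.

Lemma dyadic_open_decomposition m (U : set 'cV[R]_m) : dyadic_open U ->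
  exists (D : set nat) (n : nat -> nat) (k : nat -> {ffun 'I_m -> int}),
    U = \bigcup_(i in D) dyadic_cell (n i) (k i) /\
    trivIset D (fun i => dyadic_cell (n i) (k i) : set 'cV[R]_m).
Proof.
move=> oU.
(* each point goes to its maximal dyadic cell contained in U *)
pose good (nk : nat * {ffun 'I_m -> int}) :=
  dyadic_cell nk.1 nk.2 `<=` U /\
  forall (x : 'cV[R]_m) n', dyadic_cell nk.1 nk.2 x -> (n' < nk.1)%N ->
    ~ dyadic_cell n' (dyadic_index n' x) `<=` U.
pose dec i := odflt (0%N, [ffun=> 0 : int]) (unpickle i) : nat * {ffun 'I_m -> int}.
have decK nk : dec (pickle nk) = nk by rewrite /dec pickleK.
exists (pickle @` good), (fun i => (dec i).1), (fun i => (dec i).2); split.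
  apply/seteqP; split => [x Ux|x [_ [nk [+ _] <-]]]; last by rewrite decK; apply.
  have exn : exists n, `[< dyadic_cell n (dyadic_index n x) `<=` U >].
    by have [n nU] := oU x Ux; exists n; exact/asboolP.
  case: (ex_minnP exn) => n /asboolP nU nmin.
  exists (pickle (n, dyadic_index n x)); last first.
    by rewrite decK; exact/dyadic_cellP.
  exists (n, dyadic_index n x) => //; split => //.
  move=> y n' /= /dyadic_cellP xy n'n; rewrite -(dyadic_index_nested (ltnW n'n) xy).
  by move=> /asboolP/nmin; rewrite leqNgt n'n.
move=> _ _ [[n k] [nkU nkmin] <-] [[n' k'] [nkU' nkmin'] <-] [x []].
rewrite !decK /= => kx k'x.
have [nn'|n'n|nn'] := ltngtP n n'.
- by case: (nkmin' x n k'x nn'); move/dyadic_cellP : kx => <-.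
- by case: (nkmin x n' kx n'n); move/dyadic_cellP : k'x => <-.
- by move: kx k'x => /dyadic_cellP-> /dyadic_cellP->; rewrite nn'.
Qed.

(** Closing the disjoint cells of the decomposition into boxes keeps their volumes. A set whose
    preimage has small measure therefore has a cover of equally small total volume. *)
Lemma dyadic_open_cover m d (T : measurableType d) (mu : {measure set T -> \bar R})
    (phi : T -> 'cV[R]_m) (U : set 'cV[R]_m) :
  dyadic_chart mu phi -> dyadic_open U ->
  measurable (phi @^-1` U) /\
  exists (D : set nat) (a b : nat -> 'cV[R]_m),
    [/\ (forall k i, a k i 0 <= b k i 0),
        U `<=` \bigcup_(k in D)
          [set x | forall i, a k i 0 <= x i 0 /\ x i 0 <= b k i 0] &
        (\esum_(k in D) (\prod_(i < m) (b k i 0 - a k i 0))%:E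
           = mu (phi @^-1` U))%E].
Proof.
move=> chart /dyadic_open_decomposition[D [n [k [UE Dtriv]]]].
have phiU : phi @^-1` U = \bigcup_(i in D) (phi @^-1` dyadic_cell (n i) (k i)).
  by rewrite UE preimage_bigcup.
split; first by rewrite phiU; apply: bigcup_measurable => i _; have [] := chart (n i) (k i).
pose a l : 'cV[R]_m := \col_i (2^-1 ^+ n l * (k l i)%:~R).
pose b l : 'cV[R]_m := \col_i (2^-1 ^+ n l * (k l i)%:~R + 2^-1 ^+ n l).
exists D, a, b; split.
- by move=> l i; rewrite !mxE lerDl exprn_ge0.
- rewrite UE => x [l Dl xl]; exists l => // i.
  have := xl i; rewrite -[_ = _]/([set t | Num.floor (2 ^+ n l * t) = k l i] (x i 0)).
  by rewrite floor_itvE /= in_itv/= !mxE => /andP[-> /ltW].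
- rewrite phiU measure_bigcup//.
  + rewrite nneseries_esum// set_mem_set; apply: eq_esum => l _.
    have [_ ->] := chart (n l) (k l).
    rewrite (eq_bigr (fun=> 2^-1 ^+ n l)); last first.
      by move=> i _; rewrite !mxE addrAC subrr add0r.
    by rewrite prodr_const card_ord.
  + by move=> i _; have [] := chart (n i) (k i).
  + move=> i j Di Dj [t [ti tj]]; apply: Dtriv => //.
    by exists (phi t).
Qed.

Lemma lebesgue_null_shift m (u : 'cV[R]_m) (A : set 'cV[R]_m) :
  lebesgue_null [set x | A (x + u)] -> lebesgue_null A.
Proof.
move=> H e /H[D [a [b [ab AD De]]]].
exists D, (fun k => a k + u), (fun k => b k + u); split.
- by move=> k i; rewrite !mxE lerD2r.
- move=> x Ax; have [|k Dk Hk] := AD (x - u); first by rewrite /= subrK.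
  by exists k => // i; have := Hk i; rewrite !mxE lerBrDr lerBlDr.
- apply: le_trans De; apply: le_esum => k _; rewrite lee_fin le_eqVlt; apply/orP; left.
  by apply/eqP/eq_bigr => i _; rewrite !mxE opprD addrACA subrr addr0.
Qed.

(** Inside the unit cube the finite intersections decrease to a set of product measure zero, by
    integrating over its null sections. By continuity from above one of them has measure below [e];
    being dyadic open, it supplies the cover. *)
Lemma gdelta_null_sections_cube m (j : 'I_m) (E : nat -> set 'cV[R]_m) :
  (forall n, open (E n)) ->
  (forall x, (@lebesgue_measure R).-negligible
     [set t | t \in `[0, 1] /\ forall n, E n (x + t *: delta_mx j 0)]) ->
  lebesgue_null (\bigcap_n E n `&` dyadic_cell 0 [ffun=> 0 : int]).
Proof.
case: m j E => [|m] j E oE nE; first by have [] := j.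
set k : {ffun 'I_m.+1 -> int} := [ffun=> 0].
have [d [T [mu [phi chart]]]] := dyadic_chart_exists R m.
have := dyadic_chart_insert j chart; set nu := (_ \x^ _)%E; set psi := insert_coord _ _.
move=> chart'.
(* [G 0] is the bare cube, whose finite measure permits continuity from above. *)
pose G n : set 'cV[R]_m.+1 := (\bigcap_(i < n) E i) `&` dyadic_cell 0 k.
have oG n : dyadic_open (G n).
  apply: dyadic_openI; last exact: dyadic_open_cell.
  apply: open_dyadic_open; rewrite bigcap_mkord.
  by elim/big_ind : _ => // [|A B]; [exact: openT|exact: openI].
have mG n : measurable (psi @^-1` G n) by have [] := dyadic_open_cover chart' (oG n).
have mGE : measurable (\bigcap_n (psi @^-1` G n)) by exact: bigcapT_measurable.
have G0 : nu (\bigcap_n (psi @^-1` G n)) = 0%E.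
  rewrite /nu /product_measure2 integral0_eq// => y _ /=.
  (* Inserting [t] at coordinate [j] is the same as moving by [t] along axis [j] from [psi (0, y)],
     so the section over [y] lies in the null set given for that base point. *)
  have [A [mA A0 sA]] := nE (psi (0, y)).
  apply/eqP; rewrite eq_le measure_ge0 andbT -A0 le_measure ?inE//.
    exact: measurable_ysection.
  move=> t; rewrite /ysection /= inE => Gt; apply: sA; split=> [|n].
    have [_ /(_ j)] := Gt 0%N Logic.I; rewrite !mxE unlift_none/= expr0 mul1r ffunE.
    move=> t0; have := floor_itv t; rewrite t0 add0r => /andP[? ?].
    by rewrite in_itv/=; apply/andP; split => //; exact: ltW.
  have [+ _] := Gt n.+1 Logic.I; move=> /(_ n (ltnSn n)).
  congr (E n _); apply/matrixP => i i'; rewrite !mxE ord1 eqxx andbT.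
  case: unliftP => [i0 ->|->] /=; last by rewrite eqxx mulr1 add0r.
  by rewrite eq_sym (negbTE (neq_lift _ _)) mulr0 addr0.
have cvgG : nu (psi @^-1` G n) @[n --> \oo] --> 0%E.
  rewrite -G0; apply: nonincreasing_cvg_mu => //.
  - have -> : G 0%N = dyadic_cell 0 k.
      by rewrite /G bigcap_mkord big_ord0 setTI.
    have [_ muk] := chart' 0%N k; apply: le_lt_trans (ltry ((2^-1 ^+ 0) ^+ m.+1)).
    by rewrite -muk.
  - move=> n n' nn'; apply/subsetPset => t [Et kt]; split=> // i /= ni.
    by apply: Et => /=; exact: leq_trans ni nn'.
move=> e e0.
have /cvgG[n _ /(_ n (leqnn n))/= ne] : nbhs (0%E : \bar R) [set y | (y < e%:E)%E].
  by apply: open_ereal_lt'; rewrite lte_fin.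
have [_ [D [a [b [ab UD DE]]]]] := dyadic_open_cover chart' (oG n).
exists D, a, b; split => //; last by rewrite DE ltW.
by apply: subset_trans UD => x [Ex kx]; split => // i _; exact: Ex.
Qed.

(** The space is cut into countably many integer cubes, and each is translated to the base cube. *)
Lemma gdelta_null_sections m (j : 'I_m) (E : nat -> set 'cV[R]_m) :
  (forall n, open (E n)) ->
  (forall x, (@lebesgue_measure R).-negligible
     [set t | t \in `[0, 1] /\ forall n, E n (x + t *: delta_mx j 0)]) ->
  lebesgue_null (\bigcap_n E n).
Proof.
move=> oE nE.
apply: (@lebesgue_nullS _ _ _ (\bigcup_k (\bigcap_n E n `&` dyadic_cell 0 k))).
  by move=> x Ex; exists (dyadic_index 0 x) => //; split => //; exact/dyadic_cellP.
apply: lebesgue_null_bigcup => k; pose u : 'cV[R]_m := \col_i (k i)%:~R.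
apply: (@lebesgue_null_shift _ u).
apply: lebesgue_nullS (gdelta_null_sections_cube (j := j)
  (E := fun n => [set x | E n (x + u)]) _ _).
- move=> x [Ex kx]; split=> // i; rewrite ffunE.
  by have := kx i; rewrite !expr0 !mul1r !mxE floorDrz ?intr_int// intrKfloor => /eqP;
    rewrite -subr_eq0 addrK => /eqP.
- move=> n; apply: open_comp (oE n) => x _.
  apply: (@lipschitz_continuous _ _ _ (+%R^~ u) 1) => y z.
  by rewrite opprD addrACA subrr addr0 mul1r.
- by move=> x; apply: negligibleS (nE (x + u)) => t [t01 H]; split => // n;
    have := H n; rewrite /= addrAC.
Qed.

End Fubini.

(** * Porosity *)

Section Porosity.
Variable R : realType.

(** A hole of radius [e * |h|] centred at [t + h] lies in the ball of radius [2 * |h|] around [t]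
    and fills the fraction [e / 2] of it. Such holes at arbitrarily small scales contradict density
    1, which holds at almost every point of [K]. *)
Lemma density_points_line (K : set R) (e : R) : closed K -> 0 < e -> e <= 1 ->
  (@lebesgue_measure R).-negligible [set t | K t /\
    forall n : nat, exists h, `|h| <= n.+1%:R^-1 /\
      forall s, `|s - h| <= e * `|h| -> ~ K (t + s)].
Proof.
move=> Kc e0 e1; have mK := closed_measurable Kc.
have := lebesgue_density mK; apply: negligibleS => t /= [Kt bad] H.
move: H; rewrite indicE mem_set//=.
move=> /(_ [set y | ((1 - e / 2)%:E < y)%E]).
have H1 : nbhs (1%R%:E : \bar R) [set y | ((1 - e / 2)%:E < y)%E].
  by apply: open_ereal_gt'; rewrite lte_fin ltrBlDr ltrDl divr_gt0.
move=> /(_ H1); rewrite /fmap/= near_simpl => -[d /= d0 Hd].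
have [n] : exists n : nat, n.+1%:R^-1 < d / 2 :> R.
  have d20 : 0 < d / 2 by rewrite divr_gt0.
  have [n _ nd] := near_infty_natSinv_lt (PosNum d20).
  by exists n; exact: (nd n (leqnn n)).
move=> nd; have [h [hn hK]] := bad n.
(* With [h = 0] the choice [s = 0] would put [t] itself outside [K]. *)
have h0 : 0 < `|h|.
  rewrite normr_gt0; apply/eqP => h0; apply: (hK 0); last by rewrite addr0.
  by rewrite h0 subrr normr0 mulr0.
have r0 : 0 < 2 * `|h| by rewrite mulr_gt0.
have r1 := ltW r0.
have : ball_ [eta Num.Def.normr] 0 d (2 * `|h|).
  rewrite /= sub0r normrN gtr0_norm// -ltr_pdivlMl//.
  by rewrite mulrC; exact: le_lt_trans hn nd.
move=> /Hd/(_ r0)/=; apply/negP; rewrite -leNgt.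
rewrite lebesgue_measure_ball// inver mulrn_eq0/= gt_eqF//.
pose J := ball (t + h) (e * `|h|).
have mJ : lebesgue_measure J = ((e * `|h|) *+ 2)%:E.
  by rewrite lebesgue_measure_ball// mulr_ge0// ltW.
have JB : J `<=` ball t (2 * `|h|).
  move=> y; rewrite /J -!ball_normE /= => yJ.
  have -> : t - y = (t + h - y) + (- h) by lra.
  rewrite (le_lt_trans (ler_normD _ _))// normrN.
  have : e * `|h| <= `|h| by rewrite ger_pMl.
  lra.
have KJ : (K `&` ball t (2 * `|h|)) `&` J = set0.
  rewrite -subset0 => y [[Ky _]]; rewrite /J -ball_normE /= => yJ.
  apply: (hK (y - t)); last by rewrite addrC subrK.
  by rewrite distrC opprB addrA (addrC h) ltW.
have : (lebesgue_measure (K `&` ball t (2 * `|h|)) + lebesgue_measure J <=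
        lebesgue_measure (ball t (2 * `|h|)))%E.
  rewrite -measureU//; last 2 first.
    by apply: measurableI => //; exact: measurable_ball.
    exact: measurable_ball.
  rewrite le_measure ?inE//; last 2 first.
    exact: measurable_ball.
    by move=> y [[]|/JB].
  apply: measurableU; last exact: measurable_ball.
  by apply: measurableI => //; exact: measurable_ball.
rewrite mJ lebesgue_measure_ball//.

have [a ->] : exists a, lebesgue_measure (K `&` ball t (2 * `|h|)) = a%:E.
  exists (fine (lebesgue_measure (K `&` ball t (2 * `|h|)))); rewrite fineK//.
  rewrite ge0_fin_numE//; apply: (@le_lt_trans _ _ (lebesgue_measure (ball t (2 * `|h|)))).
    rewrite le_measure ?inE//; last exact: measurable_ball.
    by apply: measurableI => //; exact: measurable_ball.
  by rewrite lebesgue_measure_ball// ltry.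
rewrite -EFinD -EFinM !lee_fin => H.
by rewrite ler_pdivrMr ?mulrn_wgt0//; move: H; rewrite !(mulr2n (_ * _)) => H; lra.
Qed.

Definition nonporous m (S : set 'cV[R]_m) (x : 'cV[R]_m) : Prop :=
  forall e : R, 0 < e -> exists2 d : R, 0 < d &
    forall h : 'cV[R]_m, `|h| < d -> exists2 y, S y & `|x + h - y| <= e * `|h|.

Lemma open_nbhd m (S : set 'cV[R]_m) (e : R) :
  open (\bigcup_(y in S) (ball y e : set 'cV[R]_m)).
Proof. by apply: bigcup_open => y _; exact: ball_open. Qed.

Lemma closed_gdelta m (S : set 'cV[R]_m) : closed S ->
  \bigcap_n (\bigcup_(y in S) (ball y n.+1%:R^-1 : set 'cV[R]_m)) = S.
Proof.
move=> Sc; apply/seteqP; split => [x Sx|x Sx n _]; last first.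
  by exists x => //; apply: ballxx; rewrite invr_gt0.
apply: Sc => B /nbhs_ballP[e /= e0 eB].
have [n _ /(_ n (leqnn n))/= ne] := near_infty_natSinv_lt (PosNum e0).
have [y Sy yx] := Sx n Logic.I; exists y; split => //; apply: eB.
by apply: ball_sym; exact: le_ball (ltW ne) _ yx.
Qed.

Lemma delta_line_continuous m (j : 'I_m) (x : 'cV[R]_m) :
  continuous (fun t : R => x + t *: delta_mx j 0 : 'cV[R]_m).
Proof.
move=> t; apply: cvgD; first exact: cvg_cst.
by apply: cvgZr_tmp; exact: cvg_id.
Qed.

(** Tube lemma: the segment of values [s] is compact and the complement of [S] is open. *)
Lemma open_line_hole m (j : 'I_m) (S : set 'cV[R]_m) (e t : R) : closed S ->
  open [set x : 'cV[R]_m |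
    forall s, `|s - t| <= e * `|t| -> ~ S (x + s *: delta_mx j 0)].
Proof.
move=> Sc; rewrite openE => x /= Hx.
have /compact_near_coveringP cI := @segment_compact R (t - e * `|t|) (t + e * `|t|).
have : \forall y \near x, `[t - e * `|t|, t + e * `|t|]%classic `<=`
    (fun s => ~ S (y + s *: delta_mx j 0)).
  apply: (cI _ (nbhs x) (fun y s => ~ S (y + s *: delta_mx j 0))) => s; rewrite /= in_itv/= -ler_distl => /Hx Sxs.
  have Snbhs : nbhs (x + s *: delta_mx j 0) (~` S).
    by apply: open_nbhs_nbhs; split => //; exact: closed_openC.
  have Hc : (fun z : R * 'cV[R]_m => z.2 + z.1 *: delta_mx j 0 : 'cV[R]_m) z
      @[z --> (s, x)] --> x + s *: delta_mx j 0.
    by apply: cvgD; [exact: cvg_snd|apply: cvgZr_tmp; exact: cvg_fst].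
  exact: Hc Snbhs.
by apply: filterS => y Hy s st; apply: Hy; rewrite /= in_itv/= -ler_distl.
Qed.

(** Induction on the number [k] of leading coordinates in which [h] may move. The points of [S]
    without holes along axis [k] below a fixed scale form a closed set, to which the induction
    hypothesis applies. From there one more step along axis [k] ends in [S], and each of the two
    moves costs half of the error. *)
Lemma nonporous_partial m (k : nat) (S : set 'cV[R]_m) (e : R) :
  closed S -> 0 < e -> e <= 1 ->
  almost_all (fun x => S x -> exists2 d : R, 0 < d &
    forall h : 'cV[R]_m, (forall i : 'I_m, (k <= i)%N -> h i 0 = 0) -> `|h| < d ->
      exists2 y, S y & `|x + h - y| <= e * `|h|).
Proof.
elim: k S e => [|k IH] S e Sc e0 e1.
  apply: almost_allT => x Sx; exists 1 => // h h0 _.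
  have -> : h = 0 by apply/matrixP => i j; rewrite ord1 mxE h0.
  by exists x => //; rewrite addr0 subrr normr0 mulr0.
have [mk|km] := leqP m k.
  apply: almost_allW (IH S e Sc e0 e1) => x H /H[d d0 Hd]; exists d => // h _ hd.
  by apply: Hd => // i ki; have := leq_trans (ltn_ord i) mk; rewrite ltnNge ki.
pose j := Ordinal km; have e20 : 0 < e / 2 by rewrite divr_gt0.
have e21 : e / 2 <= 1 by lra.
pose hole t := [set x : 'cV[R]_m |
    forall s, `|s - t| <= e / 2 * `|t| -> ~ S (x + s *: delta_mx j 0)].
pose bad n := \bigcup_(t in [set t | `|t| <= n.+1%:R^-1]) hole t.
pose Sn n := S `&` ~` bad n.
have bad_open n : open (bad n) by apply: bigcup_open => t _; exact: open_line_hole.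
have Snc n : closed (Sn n) by apply: closedI => //; exact: open_closedC.
(* The intersection of the [E n] consists of the points of [S] with holes along axis [j] at
   arbitrarily small scales, written as a G_delta so that null sections suffice. *)
pose E n := bad n `&` \bigcup_(y in S) (ball y n.+1%:R^-1 : set 'cV[R]_m).
have E0 : lebesgue_null (\bigcap_n E n).
  apply: (gdelta_null_sections (j := j)) => [n|x].
    by apply: openI => //; exact: open_nbhd.
  pose K := [set t | S (x + t *: delta_mx j 0)].
  have Kc : closed K.
    by apply: closed_comp Sc => t _; exact: delta_line_continuous.
  apply: negligibleS (density_points_line Kc e20 e21) => t [_ Et]; split.
    rewrite /K /= -(closed_gdelta Sc) => n _; by have [] := Et n.
  move=> n; have [[h hn Hh] _] := Et n; exists h; split=> // s /Hh.
  by rewrite /K /= scalerDl addrA.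
have IHn n := IH (Sn n) (e / 2) (Snc n) e20 e21.
have := almost_allI (almost_all_forall IHn) (_ : almost_all (~` \bigcap_n E n)).
move=> /(_ _)/almost_allW; apply; last first.
  by apply: lebesgue_nullS E0 => x /contrapT.
move=> x [Hx /existsNP[n]] NEn Sx.
have Snx : Sn n x.
  split=> // badx; apply: NEn => _; split => //.
  by exists x => //; apply: ballxx; rewrite invr_gt0.
have [d d0 Hd] := Hx n Snx.
exists (Num.min d n.+1%:R^-1); first by rewrite lt_min d0/= invr_gt0 ltr0n.
move=> h hk; rewrite lt_min => /andP[hd hn].
(* [h'] is followed up to a point [y] of [Sn n]. As [y] is not in [bad n], the displacement [h j 0]
   is not the centre of a hole seen from [y], so [S] is met nearby on the line through [y]. *)
pose h' := h - h j 0 *: delta_mx j 0.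
have h'E i : h' i 0 = if i == j then 0 else h i 0.
  rewrite !mxE eqxx andbT; case: eqP => [->|_]; first by rewrite mulr1 subrr.
  by rewrite mulr0 subr0.
have h'h : `|h'| <= `|h|.
  apply/mx_norm_leP => // i i'; rewrite ord1 h'E; case: ifP => _.
    by rewrite normr0.
  exact: mx_norm_entry.
have [] := Hd h'.
- move=> i ki; rewrite h'E; case: eqP => // /eqP ij; apply: hk.
  by rewrite ltn_neqAle ki andbT; apply: contra ij => /eqP ki'; exact/eqP/val_inj/esym.
- exact: le_lt_trans hd.
move=> y [Sy nbad] xy.
have hjh := mx_norm_entry h j 0.
have : ~ hole (h j 0) y.
  by move=> Hy; apply: nbad; exists (h j 0) => //=; exact: le_trans (ltW hn).
move=> /existsNP[s] /not_implyP[sh /contrapT Sys].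
exists (y + s *: delta_mx j 0) => //.
have -> : x + h - (y + s *: delta_mx j 0) =
    (x + h' - y) + (h j 0 - s) *: delta_mx j 0.
  by rewrite /h' scalerBl; apply/matrixP => i i'; rewrite !mxE; ring.
apply: (le_trans (ler_normD _ _)); rewrite normrZ.
have d1 : `|delta_mx j 0 : 'cV[R]_m| <= 1.
  apply/mx_norm_leP => // i i'; rewrite mxE.
  by case: (_ && _); rewrite ?normr1 ?normr0.
rewrite (distrC (h j 0)) (@le_trans _ _ (e / 2 * `|h'| + `|s - h j 0|))//.
  by rewrite lerD// ler_piMr.
apply: (@le_trans _ _ (e / 2 * `|h| + e / 2 * `|h|)); last by lra.
rewrite lerD//; first by rewrite ler_pM2l.
by apply: le_trans sh _; rewrite ler_pM2l.
Qed.

(* No measurability of S is needed: the bad points of S are bad for its closure. *)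
Lemma nonporous_almost_all m (S : set 'cV[R]_m) :
  almost_all (fun x => S x -> nonporous S x).
Proof.
have He (l : nat) : almost_all (fun x => closure S x -> exists2 d : R, 0 < d &
    forall h : 'cV[R]_m, `|h| < d ->
      exists2 y, closure S y & `|x + h - y| <= l.+1%:R^-1 * `|h|).
  have := @nonporous_partial m m (closure S) l.+1%:R^-1 (@closed_closure _ S).
  rewrite invr_gt0 ltr0n invf_le1 ?ltr0n// ler1n => /(_ isT isT).
  apply: almost_allW => x H /H[d d0 Hd]; exists d => // h hd; apply: Hd => // i.
  by rewrite leqNgt ltn_ord.
apply: almost_allW (almost_all_forall He) => x Hx Sx e e0.
have e20 : 0 < e / 2 by rewrite divr_gt0.
have [l _ /(_ l (leqnn l))/= le] := near_infty_natSinv_lt (PosNum e20).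
have [d d0 Hd] := Hx l (subset_closure Sx); exists d => // h /Hd[y Sy xy].
have [->|h0] := eqVneq h 0.
  by exists x => //; rewrite addr0 subrr normr0 mulr0.
have eh : 0 < e / 2 * `|h| by rewrite mulr_gt0 ?normr_gt0.
have [z [Sz yz]] := Sy _ (nbhsx_ballx y _ eh).
exists z => //; have -> : x + h - z = (x + h - y) + (y - z) by rewrite addrA subrK.
apply: (le_trans (ler_normD _ _)).
rewrite -ball_normE /= in yz.
apply: (@le_trans _ _ (e / 2 * `|h| + e / 2 * `|h|)); last by lra.
rewrite lerD ?(ltW yz)//; apply: (le_trans xy).
by rewrite ler_wpM2r// ltW.
Qed.

End Porosity.

(** * Norms and first-order expansions *)

Section Frobenius.
Variable R : realType.

Lemma sum_sqr_ge0 (I : finType) (f : I -> R) : 0 <= \sum_i f i ^+ 2.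
Proof. by apply: sumr_ge0 => i _; exact: sqr_ge0. Qed.

Lemma cauchy_schwarz (I : finType) (f g : I -> R) :
  \sum_i f i * g i <= Num.sqrt (\sum_i f i ^+ 2) * Num.sqrt (\sum_i g i ^+ 2).
Proof.
set F := \sum_i f i ^+ 2; set G := \sum_i g i ^+ 2.
have F0 : 0 <= F := sum_sqr_ge0 f; have G0 : 0 <= G := sum_sqr_ge0 g.
have zero (u v : I -> R) : \sum_i u i ^+ 2 = 0 -> \sum_i u i * v i = 0.
  move=> /eqP; rewrite psumr_eq0 => [/allP H|i _]; last exact: sqr_ge0.
  apply: big1 => i _; have := H i (mem_index_enum i).
  by rewrite sqrf_eq0 => /eqP ->; rewrite mul0r.
have [F1|Fn0] := eqVneq F 0; first by rewrite zero// F1 sqrtr0 mul0r.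
have [G1|Gn0] := eqVneq G 0.
  by under eq_bigr do rewrite mulrC; rewrite zero// G1 sqrtr0 mulr0.
set a := Num.sqrt F; set b := Num.sqrt G.
have a0 : 0 < a by rewrite sqrtr_gt0 lt_neqAle eq_sym Fn0.
have b0 : 0 < b by rewrite sqrtr_gt0 lt_neqAle eq_sym Gn0.
have aF : a ^+ 2 = F by rewrite sqr_sqrtr.
have bG : b ^+ 2 = G by rewrite sqr_sqrtr.
rewrite -(ler_pM2l (x := 2 * (a * b))) ?mulr_gt0//.
have -> : 2 * (a * b) * (a * b) = b ^+ 2 * F + a ^+ 2 * G by rewrite -aF -bG; ring.
rewrite !mulr_sumr -big_split/=; apply: ler_sum => i _.
have := sqr_ge0 (b * f i - a * g i); rewrite sqrrB !exprMn => H.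
have -> : 2 * (a * b) * (f i * g i) = b * f i * (a * g i) *+ 2.
  by rewrite (mulr2n (_ * _)); ring.
lra.
Qed.

Lemma minkowski2 (I : finType) (f g : I -> R) :
  Num.sqrt (\sum_i (f i + g i) ^+ 2) <=
  Num.sqrt (\sum_i f i ^+ 2) + Num.sqrt (\sum_i g i ^+ 2).
Proof.
rewrite -(ler_pXn2r (n := 2))// ?nnegrE ?addr_ge0 ?sqrtr_ge0//.
rewrite sqr_sqrtr ?sum_sqr_ge0// sqrrD !sqr_sqrtr ?sum_sqr_ge0//.
have -> : \sum_i (f i + g i) ^+ 2 =
    \sum_i f i ^+ 2 + (\sum_i f i * g i) *+ 2 + \sum_i g i ^+ 2.
  by rewrite -sumrMnl -!big_split/=; apply: eq_bigr => i _; rewrite sqrrD.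
by rewrite lerD2r lerD2l lerMn2r/= cauchy_schwarz.
Qed.

Lemma frobeniusE q n (A : 'M[R]_(q, n)) :
  frobenius_norm A = Num.sqrt (\sum_(ij : 'I_q * 'I_n) A ij.1 ij.2 ^+ 2).
Proof. by rewrite /frobenius_norm pair_bigA. Qed.

Lemma frobenius_ge0 q n (A : 'M[R]_(q, n)) : 0 <= frobenius_norm A.
Proof. exact: sqrtr_ge0. Qed.

Lemma frobenius_sqr q n (A : 'M[R]_(q, n)) :
  frobenius_norm A ^+ 2 = \sum_(i < q) \sum_(j < n) A i j ^+ 2.
Proof.
by rewrite sqr_sqrtr//; apply: sumr_ge0 => i _; exact: sum_sqr_ge0.
Qed.

Lemma frobeniusD q n (A B : 'M[R]_(q, n)) :
  frobenius_norm (A + B) <= frobenius_norm A + frobenius_norm B.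
Proof.
rewrite !frobeniusE (eq_bigr (fun ij => (A ij.1 ij.2 + B ij.1 ij.2) ^+ 2)).
  exact: minkowski2.
by move=> ij _; rewrite mxE.
Qed.

Lemma frobeniusZ q n a (A : 'M[R]_(q, n)) :
  frobenius_norm (a *: A) = `|a| * frobenius_norm A.
Proof.
rewrite !frobeniusE -sqrtr_sqr -sqrtrM ?sqr_ge0// mulr_sumr.
by congr Num.sqrt; apply: eq_bigr => ij _; rewrite mxE exprMn.
Qed.

Lemma frobenius0 q n : frobenius_norm (0 : 'M[R]_(q, n)) = 0.
Proof. by rewrite -(scale0r 0) frobeniusZ normr0 mul0r. Qed.

Lemma frobeniusN q n (A : 'M[R]_(q, n)) : frobenius_norm (- A) = frobenius_norm A.
Proof. by rewrite -scaleN1r frobeniusZ normrN1 mul1r. Qed.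

Lemma frobeniusC q n (A B : 'M[R]_(q, n)) :
  frobenius_norm (A - B) = frobenius_norm (B - A).
Proof. by rewrite -frobeniusN opprB. Qed.

Lemma frobenius_dist q n (B A C : 'M[R]_(q, n)) :
  frobenius_norm (A - C) <= frobenius_norm (A - B) + frobenius_norm (B - C).
Proof.
have -> : A - C = (A - B) + (B - C) by rewrite addrA subrK.
exact: frobeniusD.
Qed.

Lemma frobenius_entry q n (A : 'M[R]_(q, n)) i j : `|A i j| <= frobenius_norm A.
Proof.
rewrite -sqrtr_sqr frobeniusE ler_wsqrtr// (bigD1 (i, j))//= lerDl.
by apply: sumr_ge0 => k _; exact: sqr_ge0.
Qed.

Lemma mx_norm_le_frobenius q n (A : 'M[R]_(q, n)) : `|A| <= frobenius_norm A.
Proof. by apply/mx_norm_leP => [|i j]; [exact: frobenius_ge0|exact: frobenius_entry]. Qed.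

Lemma frobenius_le_mx_norm q n (A : 'M[R]_(q, n)) :
  frobenius_norm A <= (q * n)%:R * `|A|.
Proof.
rewrite -(ler_pXn2r (n := 2))// ?nnegrE ?frobenius_ge0 ?mulr_ge0//.
rewrite frobenius_sqr (@le_trans _ _ (\sum_(i < q) \sum_(j < n) `|A| ^+ 2))//.
  apply: ler_sum => i _; apply: ler_sum => j _.
  by rewrite -real_normK ?num_real// ler_pXn2r ?nnegrE// mx_norm_entry.
under eq_bigr do rewrite sumr_const card_ord.
rewrite sumr_const card_ord.
have -> : `|A| ^+ 2 *+ n *+ q = (q * n)%:R * `|A| ^+ 2.
  by rewrite mulr_natl -mulrnA mulnC.
rewrite exprMn ler_wpM2r ?sqr_ge0//.
by rewrite -natrX ler_nat -mulnn; case: (q * n)%N => // k; rewrite leq_pmulr.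
Qed.

Lemma frobenius_eq0 q n (A : 'M[R]_(q, n)) : frobenius_norm A = 0 -> A = 0.
Proof.
move=> A0; apply/matrixP => i j; rewrite mxE; apply/eqP.
by rewrite -normr_le0 -A0 frobenius_entry.
Qed.

Lemma frobenius_mulmx q n r (A : 'M[R]_(q, n)) (B : 'M[R]_(n, r)) :
  frobenius_norm (A *m B) <= frobenius_norm A * frobenius_norm B.
Proof.
rewrite -(ler_pXn2r (n := 2))// ?nnegrE ?mulr_ge0 ?frobenius_ge0//.
rewrite exprMn !frobenius_sqr [X in _ * X]exchange_big/= mulr_suml.
apply: ler_sum => i _; rewrite mulr_sumr; apply: ler_sum => j _.
rewrite mxE -real_normK ?num_real//.
rewrite -[X in _ <= X]sqr_sqrtr ?mulr_ge0 ?sum_sqr_ge0//.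
rewrite ler_pXn2r ?nnegrE ?sqrtr_ge0// sqrtrM ?sum_sqr_ge0// ler_norml.
rewrite cauchy_schwarz andbT lerNl.
have -> : - (\sum_k A i k * B k j) = \sum_k (- A i k) * B k j.
  by rewrite -sumrN; apply: eq_bigr => k _; rewrite mulNr.
apply: le_trans (cauchy_schwarz _ _) _.
have -> : \sum_k (- A i k) ^+ 2 = \sum_k A i k ^+ 2.
  by apply: eq_bigr => k _; rewrite sqrrN.
by [].
Qed.

Lemma frobenius_col_mx0 q1 q2 n (A : 'M[R]_(q1, n)) :
  frobenius_norm (col_mx A (0 : 'M[R]_(q2, n))) = frobenius_norm A.
Proof.
rewrite /frobenius_norm big_split_ord/=; congr Num.sqrt.
rewrite [X in _ + X]big1 ?addr0 => [|i _]; last first.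
  by apply: big1 => j _; rewrite col_mxEd mxE expr0n.
by apply: eq_bigr => i _; apply: eq_bigr => j _; rewrite col_mxEu.
Qed.

Lemma frobenius_lsubmx q n1 n2 (M : 'M[R]_(q, n1 + n2)) :
  frobenius_norm (lsubmx M) <= frobenius_norm M.
Proof.
rewrite ler_wsqrtr//; apply: ler_sum => i _; rewrite big_split_ord/=.
under eq_bigr do rewrite mxE; rewrite lerDl; exact: sum_sqr_ge0.
Qed.

Lemma frobenius_rsubmx q n1 n2 (M : 'M[R]_(q, n1 + n2)) :
  frobenius_norm (rsubmx M) <= frobenius_norm M.
Proof.
rewrite ler_wsqrtr//; apply: ler_sum => i _; rewrite big_split_ord/=.
under eq_bigr do rewrite mxE; rewrite lerDr; exact: sum_sqr_ge0.
Qed.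

Lemma operator_norm_vec q n (A : 'M[R]_(q, n)) (v : 'cV[R]_n) :
  frobenius_norm (A *m v) <= operator_norm A * frobenius_norm v.
Proof.
have [v0|v0] := eqVneq (frobenius_norm v) 0.
  by rewrite (frobenius_eq0 v0) mulmx0 !frobenius0 mulr0.
have v1 : 0 < frobenius_norm v by rewrite lt_neqAle eq_sym v0 frobenius_ge0.
rewrite -ler_pdivrMr//; apply: ub_le_sup.
  exists (frobenius_norm A) => _ [w /= w1 <-].
  by apply: le_trans (frobenius_mulmx _ _) _; rewrite ler_piMr ?frobenius_ge0.
exists ((frobenius_norm v)^-1 *: v).
  by rewrite /= frobeniusZ gtr0_norm ?invr_gt0// mulVf.
by rewrite -scalemxAr frobeniusZ gtr0_norm ?invr_gt0// mulrC.
Qed.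

(** The squared Frobenius norm is the sum of the squared Euclidean norms of the columns, and [A]
    acts on each column separately. *)
Lemma operator_norm_mulmx q n r (A : 'M[R]_(q, n)) (B : 'M[R]_(n, r)) (c : R) :
  operator_norm A <= c -> 0 <= c ->
  frobenius_norm (A *m B) <= c * frobenius_norm B.
Proof.
move=> Ac c0; rewrite -(ler_pXn2r (n := 2))// ?nnegrE ?mulr_ge0 ?frobenius_ge0//.
rewrite exprMn !frobenius_sqr exchange_big/= [X in _ <= _ * X]exchange_big/= mulr_sumr.
apply: ler_sum => j _.
have E m (M : 'M[R]_(m, r)) : \sum_(i < m) M i j ^+ 2 = frobenius_norm (col j M) ^+ 2.
  by rewrite frobenius_sqr; apply: eq_bigr => i _; rewrite big_ord1 mxE.
rewrite !E colE -mulmxA -colE -exprMn.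
rewrite ler_pXn2r ?nnegrE ?mulr_ge0 ?frobenius_ge0//.
apply: le_trans (operator_norm_vec _ _) _.
by rewrite ler_wpM2r ?frobenius_ge0.
Qed.

End Frobenius.

Section Expansion.
Variable R : realType.

Definition expansion n q (f : 'cV[R]_n -> 'cV[R]_q) (z : 'cV[R]_n)
    (D : 'M[R]_(q, n)) : Prop :=
  forall e : R, 0 < e -> exists2 d : R, 0 < d &
    forall h : 'cV[R]_n, `|h| < d -> `|f (z + h) - f z - D *m h| <= e * `|h|.

Lemma mx_norm_mulmx q n r (A : 'M[R]_(q, n)) (B : 'M[R]_(n, r)) :
  `|A *m B| <= n%:R * `|A| * `|B|.
Proof.
apply/mx_norm_leP => [|i j]; first by rewrite !mulr_ge0.
rewrite mxE (le_trans (ler_norm_sum _ _ _))//.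
have -> : n%:R * `|A| * `|B| = \sum_(k < n) (`|A| * `|B|).
  by rewrite sumr_const card_ord -mulrA mulr_natl.
by apply: ler_sum => k _; rewrite normrM ler_pM// mx_norm_entry.
Qed.

Lemma mulmx_continuous q n r (A : 'M[R]_(q, n)) :
  continuous (mulmx A : 'M[R]_(n, r) -> 'M[R]_(q, r)).
Proof.
move=> B U /nbhs_ballP[e /= e0 eU].
set c := n%:R * `|A|.
have c0 : 0 < c + 1 by rewrite ltr_wpDl// mulr_ge0.
apply/nbhs_ballP; exists (e / (c + 1)); first by rewrite /= divr_gt0.
move=> C; rewrite -ball_normE/= ltr_pdivlMr// mulrC => BC; apply: eU.
rewrite -ball_normE/= -mulmxBr.
apply: le_lt_trans (mx_norm_mulmx _ _) (le_lt_trans _ BC).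
by rewrite ler_wpM2r// lerDl.
Qed.

Lemma diff_mulmx n q (f : 'cV[R]_n -> 'cV[R]_q) z h :
  'd f z h = Jac f z *m h.
Proof.
have {1}-> : h = \sum_j h j 0 *: delta_mx j 0.
  apply/colP => i; rewrite summxE (bigD1 i)//= !mxE !eqxx mulr1 big1 ?addr0// => j ji.
  by rewrite !mxE eq_sym (negbTE ji) mulr0.
rewrite linear_sum; apply/colP => i; rewrite summxE mxE; apply: eq_bigr => j _.
by rewrite linearZ/= !mxE mulrC.
Qed.

Lemma differentiable_expansion n q (f : 'cV[R]_n -> 'cV[R]_q) z :
  differentiable f z -> expansion f z (Jac f z).
Proof.
move=> /diff_locally/eqaddoP H e e0.
have /nbhs_ballP[d /= d0 Hd] := H e e0.
exists d => // h hd; have := Hd h.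
rewrite -ball_normE/= sub0r normrN => /(_ hd).
by rewrite !fctE /= diff_mulmx opprD addrA (addrC h).
Qed.

Lemma expansion_differentiable n q (f : 'cV[R]_n -> 'cV[R]_q) z D :
  expansion f z D -> differentiable f z /\ Jac f z = D.
Proof.
move=> H.
have cD : continuous (mulmx D : 'cV[R]_n -> 'cV[R]_q) by exact: mulmx_continuous.
have oD e : 0 < e -> \forall h \near (0 : 'cV[R]_n),
    `|f (h + z) - (f z + D *m h)| <= e * `|h|.
  move=> e0; have [d d0 Hd] := H e e0.
  apply/nbhs_ballP; exists d => //= h; rewrite -ball_normE/= sub0r normrN => hd.
  by rewrite opprD addrA (addrC h); exact: Hd.
have dE : 'd f z = mulmx D :> ('cV[R]_n -> 'cV[R]_q).
  by apply: diff_unique => //; apply/eqaddoP => e /oD.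
split.
  apply/diff_locallyP; split; first by rewrite dE.
  by apply/eqaddoP => e /oD; rewrite dE.
by apply/matrixP => i j; rewrite mxE dE -colE mxE.
Qed.

End Expansion.

(** * Rademacher's theorem *)

Section Rademacher.
Variable R : realType.

Lemma natSinv_lt (e : R) : 0 < e -> exists n : nat, n.+1%:R^-1 < e.
Proof.
move=> e0; have [n _ /(_ n (leqnn n)) ne] := near_infty_natSinv_lt (PosNum e0).
by exists n.
Qed.

Definition locally_lipschitz n q (f : 'cV[R]_n -> 'cV[R]_q) (z : 'cV[R]_n) : Prop :=
  exists M d : R, [/\ 0 <= M, 0 < d & forall y y', `|y - z| < d -> `|y' - z| < d ->
    `|f y - f y'| <= M * `|y - y'|].

(** A displaced point [z + h] is replaced by a point [y] of [S] at distance [eta * |h|]. The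
    Lipschitz bound of [f] and the size of [D] make this replacement cheap, and the expansion along
    [S] applies at [y]. *)
Lemma nonporous_expansion n q (f : 'cV[R]_n -> 'cV[R]_q) S z D :
  locally_lipschitz f z -> nonporous S z ->
  (forall e, 0 < e -> exists2 d, 0 < d & forall y, S y -> `|y - z| < d ->
     `|f y - f z - D *m (y - z)| <= e * `|y - z|) ->
  expansion f z D.
Proof.
move=> [M [d1 [M0 d10 Hf]]] npS HS e e0.
have c0 : 0 <= n%:R * `|D| by rewrite mulr_ge0.
set c := n%:R * `|D| in c0 *.
have K0 : 0 < 2 * (M + c + 1) by nra.
(* The replacement costs [(M + c) * eta * |h|], at most [e / 2 * |h|]. Since [eta <= 1] gives
   [|y - z| <= 2 * |h|], the expansion along [S] is used with [e / 4] for the other half. *)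
pose eta := Num.min 1 (e / (2 * (M + c + 1))).
have eta0 : 0 < eta by rewrite lt_min ltr01 divr_gt0.
have eta1 : eta <= 1 by rewrite ge_min lexx.
have etae : (M + c) * eta <= e / 2.
  have : eta <= e / (2 * (M + c + 1)) by rewrite ge_min lexx orbT.
  rewrite ler_pdivlMr// => H; nra.
have e40 : 0 < e / 4 by rewrite divr_gt0.
have [d2 d20 H2] := HS _ e40; have [d3 d30 H3] := npS _ eta0.
exists (Num.min (d1 / 2) (Num.min (d2 / 2) d3)).
  by rewrite !lt_min !divr_gt0.
move=> h; rewrite !lt_min => /and3P[h1 h2 h3].
have [y Sy yh] := H3 h h3.
have yh1 : `|z + h - y| <= `|h| by apply: le_trans yh _; rewrite ler_piMl.
have yz : `|y - z| <= 2 * `|h|.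
  have -> : y - z = h - (z + h - y) by apply/matrixP => i k; rewrite !mxE; ring.
  by apply: le_trans (ler_normB _ _) _; lra.
have -> : f (z + h) - f z - D *m h =
    (f (z + h) - f y) + (f y - f z - D *m (y - z)) - D *m (z + h - y).
  rewrite !mulmxBr mulmxDr; apply/matrixP => i j; rewrite !mxE; ring.
apply: le_trans (ler_normB _ _) _.
have A1 : `|f (z + h) - f y| <= M * (eta * `|h|).
  apply: le_trans (Hf _ _ _ _) _; last by rewrite ler_wpM2l.
    by rewrite addrC addKr; have := normr_ge0 h; lra.
  by lra.
have A2 : `|f y - f z - D *m (y - z)| <= e / 4 * (2 * `|h|).
  by apply: le_trans (H2 y Sy _) _; [lra|rewrite ler_wpM2l// ltW].
have A3 : `|D *m (z + h - y)| <= c * (eta * `|h|).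
  by apply: le_trans (mx_norm_mulmx _ _) _; rewrite ler_wpM2l.
have A4 : (M + c) * eta * `|h| <= e / 2 * `|h| by rewrite ler_wpM2r.
have := ler_normD (f (z + h) - f y) (f y - f z - D *m (y - z)).
by move=> ?; lra.
Qed.

Section Partial.
Variables (m p : nat) (f : 'cV[R]_m -> 'cV[R]_p) (M : R).
Hypotheses (M0 : 0 <= M) (f_lip : forall x y, `|f x - f y| <= M * `|x - y|).

Definition diff_quot (j : 'I_m) (x : 'cV[R]_m) (t : R) : 'cV[R]_p :=
  t^-1 *: (f (x + t *: delta_mx j 0) - f x).

Lemma diff_quot_lip j t x y :
  `|diff_quot j x t - diff_quot j y t| <= `|t^-1| * (2 * M) * `|x - y|.
Proof.
rewrite /diff_quot -scalerBr normrZ -mulrA ler_wpM2l//.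
have -> : f (x + t *: delta_mx j 0) - f x - (f (y + t *: delta_mx j 0) - f y) =
  (f (x + t *: delta_mx j 0) - f (y + t *: delta_mx j 0)) - (f x - f y).
  by rewrite !opprD !opprK addrACA.
apply: le_trans (ler_normB _ _) _.
have := f_lip (x + t *: delta_mx j 0) (y + t *: delta_mx j 0).
have := f_lip x y; rewrite opprD addrACA subrr addr0; lra.
Qed.

(** Failure of the Cauchy criterion for the partial derivative at scale [1 / (n + 1)]. The strict
    inequality makes the set open, so that persistent failure is a G_delta. *)
Definition osc_set (j : 'I_m) (e : R) (n : nat) : set 'cV[R]_m :=
  [set x | exists s t, [/\ 0 < `|s| < n.+1%:R^-1, 0 < `|t| < n.+1%:R^-1 &
     e < `|diff_quot j x s - diff_quot j x t|]].

Lemma osc_set_open j e n : open (osc_set j e n).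
Proof.
have -> : osc_set j e n = \bigcup_(st in [set st : R * R |
    0 < `|st.1| < n.+1%:R^-1 /\ 0 < `|st.2| < n.+1%:R^-1])
    [set x | e < `|diff_quot j x st.1 - diff_quot j x st.2|].
  apply/seteqP; split => [x [s [t [hs ht est]]]|x [[s t] [hs ht] est]].
    by exists (s, t).
  by exists s, t.
apply: bigcup_open => -[s t] _ /=.
apply: (@open_comp _ _ (fun x => `|diff_quot j x s - diff_quot j x t|) [set r | e < r]);
  last exact: open_gt.
move=> x _; apply: (@lipschitz_continuous _ _ _ _ (`|s^-1| * (2 * M) + `|t^-1| * (2 * M))).
move=> y z; apply: le_trans (ler_dist_dist _ _) _.
have -> : diff_quot j y s - diff_quot j y t - (diff_quot j z s - diff_quot j z t) =
  (diff_quot j y s - diff_quot j z s) - (diff_quot j y t - diff_quot j z t).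
  by rewrite !opprD !opprK addrACA.
apply: le_trans (ler_normB _ _) _; rewrite mulrDl.
by rewrite lerD// diff_quot_lip.
Qed.

Lemma line_absolutely_continuous (x v : 'cV[R]_m) :
  absolutely_continuous01 (fun t => x + t *: v).
Proof.
move=> e e0; have c0 : 0 < frobenius_norm v + 1 by rewrite ltr_wpDl// frobenius_ge0.
exists (e / (frobenius_norm v + 1)); first by rewrite divr_gt0.
move=> k a b ab _; rewrite ltr_pdivlMr// => H; apply: le_lt_trans H.
rewrite mulr_suml; apply: ler_sum => i _; have [_ [abi _]] := ab i.
have -> : x + b i *: v - (x + a i *: v) = (b i - a i) *: v.
  by rewrite scalerBl opprD addrACA subrr add0r.
by rewrite frobeniusZ ger0_norm ?subr_ge0// ler_wpM2l ?subr_ge0// lerDl.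
Qed.

(** Lines parallel to the axis are absolutely continuous paths. The conservative Jacobian makes [f]
    derivable at almost every parameter of each of them, and derivability excludes oscillation at
    small scales. The sections are thus null. *)
Lemma osc_set_null J j e : 0 < e -> conservative_jacobian f J ->
  lebesgue_null (\bigcap_n osc_set j e n).
Proof.
move=> e0 [_ _ _ consJ]; apply: (gdelta_null_sections (j := j)).
  by move=> n; exact: osc_set_open.
move=> x.
have := consJ _ (line_absolutely_continuous x (delta_mx j 0)).
apply: negligibleS => t [t01 osc] /= /(_ t01)[_ /cvg_ex[a Ha] _].
have e20 : 0 < e / 2 by rewrite divr_gt0.
move/cvgrPdist_lt : Ha => /(_ _ e20)/nbhs_ballP[d /= d0 Hd].
have [n nd] := natSinv_lt d0.
have {}Hd s : 0 < `|s| < n.+1%:R^-1 ->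
    `|a - diff_quot j (x + t *: delta_mx j 0) s| < e / 2.
  move=> /andP[s0 sn]; have := Hd s; rewrite -ball_normE/= sub0r normrN.
  move=> /(_ (lt_trans sn nd)); rewrite -normr_gt0 => /(_ s0).
  by rewrite /diff_quot /= [s *: 1]mulr1 (addrC s) scalerDl addrA.
have [s [s' [/Hd hs /Hd hs']]] := osc n.
apply/negP; rewrite -leNgt.
set q := diff_quot _ _ _ in hs *; set q' := diff_quot _ _ _ in hs' *.
have -> : q - q' = (a - q') - (a - q) by apply/matrixP => i k; rewrite !mxE; ring.
apply: le_trans (ler_normB _ _) _; lra.
Qed.

Definition partial_at (j : 'I_m) (x : 'cV[R]_m) (a : 'cV[R]_p) : Prop :=
  forall e, 0 < e -> exists2 d, 0 < d & forall t, `|t| < d ->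
    `|f (x + t *: delta_mx j 0) - f x - t *: a| <= e * `|t|.

(** The difference quotients satisfy the Cauchy criterion at punctured 0, and the space is
    complete. *)
Lemma partial_exists j x : (forall l : nat, ~ (\bigcap_n osc_set j l.+1%:R^-1 n) x) ->
  exists a, partial_at j x a.
Proof.
move=> H; pose F := diff_quot j x @ 0^'.
have /cauchy_cvgP/cvg_ex[a Ha] : cauchy F.
  apply/cauchy_ballP => e e0; have [l le] := natSinv_lt e0.
  have /existsNP[n /not_implyP[_ Hn]] := H l.
  have near0 : \forall s \near (0 : R)^', (0 < `|s| < (n.+1%:R^-1 : R)).
    rewrite near_withinE; apply/nbhs_ballP; exists n.+1%:R^-1; first by rewrite /= invr_gt0.
    move=> s; rewrite -ball_normE/= sub0r normrN => sn s0.
    by rewrite normr_gt0 s0.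
  rewrite near_map2; near=> s t.
  rewrite -ball_normE/=; apply: le_lt_trans le; rewrite leNgt; apply/negP => lst.
  by apply: Hn; exists s, t; split => //; [near: s|near: t]; exact: near0.
exists a => e e0; move/cvgrPdist_le : Ha => /(_ _ e0)/nbhs_ballP[d /= d0 Hd].
exists d => // t td; have [->|t0] := eqVneq t 0.
  by rewrite !scale0r addr0 subrr subr0 !normr0 mulr0.
have := Hd t; rewrite -ball_normE/= sub0r normrN => /(_ td t0) H1.
have -> : f (x + t *: delta_mx j 0) - f x - t *: a = t *: (diff_quot j x t - a).
  by rewrite scalerBr /diff_quot scalerA mulfV// scale1r.
by rewrite normrZ mulrC ler_wpM2r// distrC.
Unshelve. all: by end_near. Qed.

(** The radius [r] is common to all points of the set, so the estimate can be used at every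
    intermediate point of a walk. *)
Definition near_affine (B : 'M[R]_(p, m)) (c r : R) : set 'cV[R]_m :=
  [set x | forall j t, `|t| < r ->
     `|f (x + t *: delta_mx j 0) - f x - t *: col j B| <= c * `|t|].

(* Walk from x to x + h along the axes, stepping back into the set S on which
   the increments along each axis are controlled before every step. *)
Lemma nonporous_near_affine B c r x : 0 < c -> 0 < r ->
  nonporous (near_affine B c r) x ->
  exists2 d, 0 < d & forall h : 'cV[R]_m, `|h| < d ->
    `|f (x + h) - f x - B *m h| <= (m%:R * (2 * c)) * `|h|.
Proof.
(* Each axis needs a detour into the set and back, at Lipschitz cost [M * eta * |h|] each way. This
   [eta] bounds both by [c * |h|]; with the increment error [c * |h|] an axis costs
   [2 * c * |h|]. *)
move=> c0 r0 np; pose eta := c / (2 * M + 1).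
have M1 : 0 < 2 * M + 1 by rewrite ltr_wpDl// mulr_ge0.
have eta0 : 0 < eta by rewrite divr_gt0.
have Meta : 2 * M * eta <= c.
  have : (2 * M + 1) * eta = c by rewrite mulrC divfK// gt_eqF.
  by move=> <-; rewrite ler_wpM2r ?(ltW eta0)// lerDl.
have [d d0 Hd] := np _ eta0.
exists (Num.min d r); first by rewrite lt_min d0.
move=> h; rewrite lt_min => /andP[hd hr].
(* The position reached after [k] axes: [h] truncated to its first [k] coordinates. *)
pose g (k : nat) : 'cV[R]_m := \col_i (if (i < k)%N then h i 0 else 0).
have gh k : `|g k| <= `|h|.
  apply/mx_norm_leP => // i i'; rewrite mxE; case: ifP => _.
    exact: mx_norm_entry.
  by rewrite normr0.
suff H k : (k <= m)%N ->
    `|f (x + g k) - f x - B *m g k| <= k%:R * (2 * c) * `|h|.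
  have -> : f (x + h) - f x - B *m h = f (x + g m) - f x - B *m g m.
    by have -> : g m = h by apply/colP => i; rewrite mxE ltn_ord.
  exact: H.
elim: k => [_|k IH km].
  have -> : g 0%N = 0 by apply/colP => i; rewrite !mxE ltn0.
  by rewrite addr0 subrr mulmx0 subr0 normr0 !mul0r.
pose j := Ordinal km.
have gS : g k.+1 = g k + h j 0 *: delta_mx j 0.
  apply/colP => i; rewrite !mxE eqxx andbT ltnS leq_eqVlt.
  have [->|ij] := eqVneq i j; first by rewrite eqxx ltnn mulr1 add0r.
  rewrite mulr0 addr0; case: eqP => // ik; case/eqP: ij; exact/val_inj.
have [y Sy xy] := Hd (g k) (le_lt_trans (gh k) hd).
have hj := mx_norm_entry h j 0.
have A := Sy j (h j 0) (le_lt_trans hj hr).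
have {}xy : `|x + g k - y| <= eta * `|h|.
  by apply: le_trans xy _; rewrite ler_pM2l.
have -> : f (x + g k.+1) - f x - B *m g k.+1 =
    (f (x + g k) - f x - B *m g k) +
    ((f (x + g k.+1) - f (y + h j 0 *: delta_mx j 0)) +
     (f (y + h j 0 *: delta_mx j 0) - f y - h j 0 *: col j B) - (f (x + g k) - f y)).
  rewrite gS mulmxDr -scalemxAr -colE; apply/matrixP => i i'; rewrite !mxE; ring.
apply: le_trans (ler_normD _ _) _.
have -> : k.+1%:R * (2 * c) * `|h| = k%:R * (2 * c) * `|h| + 2 * c * `|h|.
  by rewrite -natr1; ring.
apply: lerD; first exact: IH (ltnW km).
apply: le_trans (ler_normB _ _) _.
have A1 : `|f (x + g k.+1) - f (y + h j 0 *: delta_mx j 0)| <= M * (eta * `|h|).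
  apply: le_trans (f_lip _ _) _; rewrite gS opprD addrA (addrA x) addrAC.
  by rewrite addrK ler_wpM2l.
have A2 : `|f (x + g k) - f y| <= M * (eta * `|h|).
  by apply: le_trans (f_lip _ _) _; rewrite ler_wpM2l.
have A3 : c * `|h j 0| <= c * `|h| by rewrite ler_pM2l.
have A4 : 2 * M * eta * `|h| <= c * `|h| by rewrite ler_wpM2r.
have := ler_normD (f (x + g k.+1) - f (y + h j 0 *: delta_mx j 0))
  (f (y + h j 0 *: delta_mx j 0) - f y - h j 0 *: col j B).
move=> A5; apply: (@le_trans _ _ (M * (eta * `|h|) + c * `|h| + M * (eta * `|h|))).
  apply: lerD A2; apply: le_trans A5 _; apply: lerD A1 _; exact: le_trans A A3.
lra.
Qed.

(** Grid matrices and radii [1 / (n + 1)] give countably many sets [S t], almost all of whose points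
    are nonporous. Where all partial derivatives exist, the point lies in such a set with a grid
    matrix as close as desired to the matrix [D] of partial derivatives, and the walk along the axes
    gives the expansion. *)
Lemma lipschitz_differentiable_almost_all J : conservative_jacobian f J ->
  almost_all (fun x => differentiable f x).
Proof.
move=> consJ.
pose B (l : nat) (A : {ffun 'I_p * 'I_m -> int}) : 'M[R]_(p, m) :=
  \matrix_(i, j) (l.+1%:R^-1 * (A (i, j))%:~R).
pose S (t : nat * nat * {ffun 'I_p * 'I_m -> int}) :=
  near_affine (B t.1.1 t.2) (2 * t.1.1.+1%:R^-1) t.1.2.+1%:R^-1.
have aS := almost_all_forall (fun t => nonporous_almost_all (S t)).
have aP : almost_all (fun x => forall jl : 'I_m * nat,
    ~ (\bigcap_n osc_set jl.1 jl.2.+1%:R^-1 n) x).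
  apply: almost_all_forall => -[j l].
  have l0 : 0 < l.+1%:R^-1 :> R by rewrite invr_gt0.
  by apply: lebesgue_nullS (osc_set_null j l0 consJ) => x /contrapT.
apply: almost_allW (almost_allI aS aP) => x [npS Px].
have /choice[D' HD] : forall j, exists a, partial_at j x a.
  by move=> j; apply: partial_exists => l; exact: (Px (j, l)).
pose D : 'M[R]_(p, m) := \matrix_(i, j) D' j i 0.
have DE j : D' j = col j D by apply/colP => i; rewrite !mxE.
suff /expansion_differentiable[] : expansion f x D by [].
move=> e e0.
(* With [u = 1 / (l + 1)] the walk costs [m * (2 * (2 * u))] and replacing [B l A] by [D] costs
   [m * u], hence the 5. The successor of [m] keeps the divisor positive when [m = 0]. *)
have e50 : 0 < e / (5 * m.+1%:R) by rewrite divr_gt0// mulr_gt0.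
have [l le] := natSinv_lt e50.
pose A : {ffun 'I_p * 'I_m -> int} := [ffun ij => Num.floor (l.+1%:R * D ij.1 ij.2)].
have l0 : 0 < l.+1%:R^-1 :> R by rewrite invr_gt0.
have DB : `|D - B l A| <= l.+1%:R^-1.
  apply/mx_norm_leP => [|i j]; first exact: ltW.
  rewrite !mxE ffunE/= mxE.
  have lz : l.+1%:R != 0 :> R by [].
  rewrite -[D' j i 0 in X in `|X - _|](mulKf lz) -mulrBr normrM gtr0_norm//.
  rewrite ler_piMr ?(ltW l0)//.
  have /andP[f1 f2] := floor_itv (l.+1%:R * D' j i 0); rewrite intrD in f2.
  by rewrite ler_norml; lra.
(* One [u] comes from the partial derivatives and one from rounding [D] to the grid, which explains
   the factor 2 in [S]. *)
have [n Sx] : exists n, S (l, n, A) x.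
  have /choice[d Hd] : forall j, exists d, 0 < d /\ forall t, `|t| < d ->
     `|f (x + t *: delta_mx j 0) - f x - t *: D' j| <= l.+1%:R^-1 * `|t|.
    by move=> j; have [d d0 Hd] := HD j _ l0; exists d.
  have [n nd] : exists n : nat, forall j, n.+1%:R^-1 < d j.
    have /choice[n Hn] : forall j, exists n : nat, n.+1%:R^-1 < d j.
      by move=> j; apply: natSinv_lt; have [] := Hd j.
    exists (\max_j n j) => j; apply: le_lt_trans (Hn j).
    by rewrite lef_pV2 ?posrE// ler_nat ltnS leq_bigmax.
  exists n => j t /= tn.
  have [_ /(_ t (lt_trans tn (nd j))) H] := Hd j.
  have -> : f (x + t *: delta_mx j 0) - f x - t *: col j (B l A) =
      (f (x + t *: delta_mx j 0) - f x - t *: D' j) + t *: (D' j - col j (B l A)).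
    by rewrite scalerBr addrA subrK.
  apply: le_trans (ler_normD _ _) _; rewrite normrZ.
  have : `|D' j - col j (B l A)| <= l.+1%:R^-1.
    apply/mx_norm_leP => [|i i']; first exact: ltW.
    apply: le_trans DB; rewrite DE.
    have -> : (col j D - col j (B l A)) i i' = (D - B l A) i j by rewrite !mxE.
    exact: mx_norm_entry.
  move=> /(ler_wpM2l (normr_ge0 t)) H2; move: H H2; set u := l.+1%:R^-1.
  by move=> H H2; lra.
have c0 : 0 < 2 * l.+1%:R^-1 :> R by rewrite mulr_gt0.
have n0 : 0 < n.+1%:R^-1 :> R by rewrite invr_gt0.
have [d d0 Hd] := nonporous_near_affine c0 n0 (npS _ Sx).
exists d => // h /Hd H.
have -> : f (x + h) - f x - D *m h = (f (x + h) - f x - B l A *m h) - (D - B l A) *m h.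
  by rewrite mulmxBl opprB addrA subrK.
apply: le_trans (ler_normB _ _) _.
have H2 : `|(D - B l A) *m h| <= m%:R * l.+1%:R^-1 * `|h|.
  by apply: le_trans (mx_norm_mulmx _ _) _; rewrite ler_wpM2r// ler_wpM2l.
have H3 : 5 * m%:R * l.+1%:R^-1 <= e.
  move: le; rewrite ltr_pdivlMr ?mulr_gt0// => le; apply: le_trans (ltW le).
  by rewrite mulrC ler_pM2l// ler_pM2l// ler_nat.
have := ler_wpM2r (normr_ge0 h) H3; move: H H2; set u := l.+1%:R^-1 => H H2 H4.
lra.
Qed.

End Partial.

End Rademacher.

(** * Lipschitz gradient selections *)

Section Selection.
Variable R : realType.

(** The inverse of one plus the sum of the inverses is below every [d i], and is positive even for
    an empty index type. *)
Lemma fin_common_radius (I : finType) (d : I -> R) : (forall i, 0 < d i) ->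
  exists2 e, 0 < e & forall i, e <= d i.
Proof.
move=> d0; have s0 i : 0 <= (d i)^-1 by rewrite invr_ge0 ltW.
have S0 : 0 < 1 + \sum_i (d i)^-1 by rewrite ltr_wpDr// sumr_ge0.
exists (1 + \sum_i (d i)^-1)^-1; first by rewrite invr_gt0.
move=> i; rewrite -[leRHS]invrK lef_pV2 ?posrE ?invr_gt0//.
by rewrite (bigD1 i)//= addrCA lerDl addr_ge0// sumr_ge0.
Qed.

(** Continuous induction with slope [c + e]: the supremum of the parameters up to which the bound
    from 0 holds satisfies the bound, and could be exceeded if it were below 1. *)
Lemma local_lipschitz_segment q (g : R -> 'cV[R]_q) (c : R) :
  (forall t, 0 <= t <= 1 -> forall e, 0 < e -> exists2 d, 0 < d &
     forall t', 0 <= t' <= 1 -> `|t' - t| < d ->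
       frobenius_norm (g t' - g t) <= (c + e) * `|t' - t|) ->
  frobenius_norm (g 1 - g 0) <= c.
Proof.
move=> H; apply/ler_addgt0Pr => e e0.
pose A := [set t | 0 <= t <= 1 /\ frobenius_norm (g t - g 0) <= (c + e) * t].
have A0 : A 0 by rewrite /A /= lexx ler01 subrr frobenius0 mulr0.
have Aub : ubound A 1 by move=> t [/andP[]].
have Asup : has_sup A by split; [exists 0|exists 1].
pose s := sup A.
have s01 : 0 <= s <= 1.
  by rewrite ub_le_sup//=; [apply: ge_sup => //; exists 0|exists 1].
have [d d0 Hd] := H s s01 e e0.
have As : A s.
  split => //; have [t At ts] := sup_adherent d0 Asup.
  have tles : t <= s by apply: ub_le_sup => //; exists 1.
  have [t01 Ht] := At.
  have std : `|t - s| < d by rewrite distrC ger0_norm ?subr_ge0// ltrBlDr -ltrBlDl.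
  have := Hd t t01 std; rewrite distrC ger0_norm ?subr_ge0// => H2.
  apply: le_trans (frobenius_dist (g t) _ _) _; rewrite frobeniusC.
  by have := lerD H2 Ht; lra.
have [s1|s1] := ltP s 1; last first.
  have -> : 1 = s by apply/le_anti; rewrite s1; case/andP: s01.
  have [_ As2] := As; apply: le_trans As2 _.
  have sE : s = 1 by apply/le_anti; rewrite s1 andbT; case/andP: s01.
  by rewrite sE mulr1.
pose t := Num.min 1 (s + d / 2).
have d2 : 0 < d / 2 by rewrite divr_gt0.
have st : s < t by rewrite lt_min s1 ltrDl.
have t1 : t <= 1 by rewrite ge_min lexx.
have td : t <= s + d / 2 by rewrite ge_min lexx orbT.
have t01 : 0 <= t <= 1 by rewrite t1 andbT; case/andP: s01 => s0 _; lra.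
have tsd : `|t - s| < d by rewrite gtr0_norm ?subr_gt0//; lra.
have := Hd t t01 tsd; rewrite gtr0_norm ?subr_gt0// => H2.
suff /(ub_le_sup (ex_intro _ _ Aub)) : A t by rewrite leNgt st.
split => //; have [_ H3] := As.
apply: le_trans (frobenius_dist (g s) _ _) _.
by have := lerD H2 H3; lra.
Qed.

Section Family.
Variables (n q N : nat) (F : 'cV[R]_n -> 'cV[R]_q) (s : 'cV[R]_n -> 'I_N)
  (Fs : 'I_N -> 'cV[R]_n -> 'cV[R]_q).
Hypotheses (F_cont : continuous F) (Fs_diff : forall i z, differentiable (Fs i) z)
  (F_sel : forall z, F z = Fs (s z) z).

(** A branch that differs from [F] at [z] still differs from it nearby, by continuity; finitely many
    branches share a radius. *)
Lemma active_near z : exists2 d, 0 < d & forall y i, `|y - z| < d ->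
  F y = Fs i y -> F z = Fs i z.
Proof.
have H i : exists d, 0 < d /\ forall y, `|y - z| < d -> F y = Fs i y -> F z = Fs i z.
  have [E|/eqP NE] := pselect (F z = Fs i z); first by exists 1.
  have gap0 : 0 < `|F z - Fs i z| / 2.
    by rewrite divr_gt0// normr_gt0 subr_eq0.
  have := F_cont (x := z); move/cvgrPdist_lt => /(_ _ gap0)/nbhs_ballP[d1 /= d10 H1].
  have := differentiable_continuous (Fs_diff i z).
  move/cvgrPdist_lt => /(_ _ gap0)/nbhs_ballP[d2 /= d20 H2].
  exists (Num.min d1 d2); split; first by rewrite lt_min d10.
  move=> y; rewrite lt_min => /andP[y1 y2] FE.
  have := H1 y; rewrite -ball_normE/= distrC => /(_ y1) {}H1.
  have := H2 y; rewrite -ball_normE/= distrC => /(_ y2) {}H2.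
  have : `|F z - Fs i z| <= `|F z - F y| + `|Fs i z - Fs i y|.
    by rewrite (distrC (Fs i z)) FE; exact: ler_distD.
  by move=> ?; exfalso; lra.
have /choice[d Hd] := H.
have [e e0 He] := fin_common_radius (fun i => (Hd i).1).
exists e => // y i ye; apply: (Hd i).2; exact: lt_le_trans ye (He i).
Qed.

(** Mean value inequality for a selection. Near a point of the segment [F] takes only values of
    branches active at that point, and their derivatives along [v] are bounded by [c]; this is the
    local hypothesis of [local_lipschitz_segment]. *)
Lemma selection_segment z v c : 0 <= c ->
  (forall t i, 0 <= t <= 1 -> F (z + t *: v) = Fs i (z + t *: v) ->
     frobenius_norm (Jac (Fs i) (z + t *: v) *m v) <= c) ->
  frobenius_norm (F (z + v) - F z) <= c.
Proof.
move=> c0 H.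
have := @local_lipschitz_segment q (fun t => F (z + t *: v)) c.
rewrite scale1r scale0r addr0; apply => t t01 e e0.
have qv0 : 0 < (q * 1)%:R * `|v| + 1 by rewrite ltr_wpDl// mulr_ge0.
have e'0 : 0 < e / ((q * 1)%:R * `|v| + 1) by rewrite divr_gt0.
set e' := e / _ in e'0.
have e'E : (q * 1)%:R * e' * `|v| <= e.
  have : ((q * 1)%:R * `|v| + 1) * e' = e by rewrite mulrC divfK// gt_eqF.
  move=> E; rewrite -[leRHS]E.
  have -> : (q * 1)%:R * e' * `|v| = ((q * 1)%:R * `|v|) * e' by ring.
  by rewrite ler_pM2r// lerDl.
have [d1 d10 H1] := active_near (z + t *: v).
have /choice[d Hd] : forall i, exists d, 0 < d /\ forall h, `|h| < d ->
    `|Fs i (z + t *: v + h) - Fs i (z + t *: v) - Jac (Fs i) (z + t *: v) *m h|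
      <= e' * `|h|.
  move=> i; have [d d0 Hd] := differentiable_expansion (Fs_diff i (z + t *: v)) e'0.
  by exists d.
have [d2 d20 H2] := fin_common_radius (fun i => (Hd i).1).
have v1 : 0 < `|v| + 1 by rewrite ltr_wpDl.
exists (Num.min d1 d2 / (`|v| + 1)); first by rewrite divr_gt0// lt_min d10.
move=> t' t'01; rewrite ltr_pdivlMr// lt_min => /andP[td1 td2].
have hv : `|(t' - t) *: v| <= `|t' - t| * (`|v| + 1).
  by rewrite normrZ ler_wpM2l// lerDl.
have tE : z + t' *: v = z + t *: v + (t' - t) *: v.
  by rewrite -addrA -scalerDl subrKC.
(* The branch selected at the moving point is also active at the centre, so both values of [F]
   belong to one differentiable function. *)
pose i := s (z + t' *: v).
have Fi : F (z + t *: v) = Fs i (z + t *: v).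
  apply: H1 (F_sel _); rewrite tE addrC addKr; exact: le_lt_trans td1.
rewrite F_sel -/i Fi tE.
have := (Hd i).2 _ (lt_le_trans (le_lt_trans hv td2) (H2 i)).
set w := z + t *: v; set h := (t' - t) *: v => Hh.
have -> : Fs i (w + h) - Fs i w =
    (Fs i (w + h) - Fs i w - Jac (Fs i) w *m h) + Jac (Fs i) w *m h by rewrite subrK.
apply: le_trans (frobeniusD _ _) _; rewrite addrC mulrDl; apply: lerD.
  rewrite -scalemxAr frobeniusZ mulrC ler_wpM2r//; exact: H.
apply: le_trans (frobenius_le_mx_norm _) _.
apply: le_trans (ler_wpM2l (ler0n _ _) Hh) _.
rewrite normrZ mulrA (mulrC `|t' - t|) mulrA; exact: ler_wpM2r.
Qed.

Lemma selection_locally_lipschitz (L : R) : 0 <= L ->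
  (forall i z z', frobenius_norm (Jac (Fs i) z - Jac (Fs i) z') <=
     L * frobenius_norm (z - z')) ->
  forall z, locally_lipschitz F z.
Proof.
move=> L0 HL z.
(* Bounds every branch Jacobian on the unit ball around [z]: its norm at [z], plus [L] times a
   Frobenius bound for the unit ball of the sup norm. *)
pose M := \sum_i frobenius_norm (Jac (Fs i) z) + L * (n * 1)%:R.
have M0 : 0 <= M.
  by rewrite addr_ge0 ?mulr_ge0// sumr_ge0// => i _; exact: frobenius_ge0.
exists (M * (n * 1)%:R), 1; split => //; first by rewrite mulr_ge0.
move=> y' y y'z yz.
apply: le_trans (mx_norm_le_frobenius _) _.
have -> : F y' = F (y + (y' - y)) by rewrite subrKC.
rewrite -mulrA.
apply: le_trans (_ : _ <= M * frobenius_norm (y' - y)) _; last first.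
  by rewrite ler_wpM2l// frobenius_le_mx_norm.
apply: selection_segment; first by rewrite mulr_ge0// frobenius_ge0.
move=> t i /andP[t0 t1] _; apply: le_trans (frobenius_mulmx _ _) _.
rewrite ler_wpM2r ?frobenius_ge0//.
set w := y + _.
have wz : `|w - z| <= 1.
  have -> : w - z = t *: (y' - z) + (1 - t) *: (y - z).
    by rewrite /w; apply/matrixP => k k'; rewrite !mxE; ring.
  apply: le_trans (ler_normD _ _) _; rewrite !normrZ ger0_norm// ger0_norm ?subr_ge0//.
  have := ler_wpM2l t0 (ltW y'z).
  have : 0 <= 1 - t by lra.
  by move=> /ler_wpM2l/(_ _ _ (ltW yz)); lra.
have -> : Jac (Fs i) w = Jac (Fs i) z + (Jac (Fs i) w - Jac (Fs i) z) by rewrite subrKC.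
apply: le_trans (frobeniusD _ _) _; apply: lerD.
  rewrite (bigD1 i)//= lerDl sumr_ge0// => k _; exact: frobenius_ge0.
apply: le_trans (HL _ _ _) _; rewrite ler_wpM2l//.
by apply: le_trans (frobenius_le_mx_norm _) _; rewrite ler_piMr.
Qed.

End Family.

Lemma mx_norm_col_mx n1 n2 (a : 'cV[R]_n1) (b : 'cV[R]_n2) :
  `|col_mx a b| <= `|a| + `|b|.
Proof.
apply/mx_norm_leP => [|i j]; first by rewrite addr_ge0.
rewrite mxE; case: splitP => k _; rewrite (le_trans (mx_norm_entry _ _ _))//.
  by rewrite lerDl.
by rewrite lerDr.
Qed.

Lemma col_mxB n1 n2 n (a a' : 'M[R]_(n1, n)) (b b' : 'M[R]_(n2, n)) :
  col_mx a b - col_mx a' b' = col_mx (a - a') (b - b').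
Proof. by rewrite opp_col_mx add_col_mx. Qed.

Lemma locally_lipschitz_continuous n q (f : 'cV[R]_n -> 'cV[R]_q) z :
  locally_lipschitz f z -> forall e, 0 < e -> exists2 d, 0 < d &
    forall y, `|y - z| < d -> `|f y - f z| < e.
Proof.
move=> [M [d [M0 d0 Hf]]] e e0; have M1 : 0 < M + 1 by rewrite ltr_wpDl.
exists (Num.min d (e / (M + 1))); first by rewrite lt_min d0 divr_gt0.
move=> y; rewrite lt_min => /andP[yd]; rewrite ltr_pdivlMr// => ye.
apply: le_lt_trans (Hf _ _ yd _) _; first by rewrite subrr normr0.
by apply: le_lt_trans ye; rewrite mulrC ler_wpM2l// lerDl.
Qed.

Lemma locally_lipschitz_graph n1 n2 q (F : 'cV[R]_(n1 + n2) -> 'cV[R]_q)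
    (x : 'cV[R]_n2 -> 'cV[R]_n1) z :
  locally_lipschitz x z -> locally_lipschitz F (col_mx (x z) z) ->
  locally_lipschitz (fun y => F (col_mx (x y) y)) z.
Proof.
move=> lx [M [d [M0 d0 HF]]]; have d20 : 0 < d / 2 by rewrite divr_gt0.
have [d1 d10 H1] := locally_lipschitz_continuous lx d20.
have [M' [d' [M'0 d'0 Hx]]] := lx.
exists (M * (M' + 1)), (Num.min d' (Num.min (d / 2) d1)); split.
- by rewrite mulr_ge0// addr_ge0.
- by rewrite !lt_min d'0 d20.
have close y : `|y - z| < Num.min d' (Num.min (d / 2) d1) ->
    `|col_mx (x y) y - col_mx (x z) z| < d.
  rewrite !lt_min => /and3P[_ y2 /H1 y1]; rewrite col_mxB.
  by apply: le_lt_trans (mx_norm_col_mx _ _) _; lra.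
move=> y y' yz y'z; apply: le_trans (HF _ _ (close _ yz) (close _ y'z)) _.
rewrite -mulrA ler_wpM2l// col_mxB; apply: le_trans (mx_norm_col_mx _ _) _.
rewrite mulrDl mul1r lerD2r; apply: Hx.
  by move: yz; rewrite lt_min => /andP[].
by move: y'z; rewrite lt_min => /andP[].
Qed.

Lemma expansion_graph n1 n2 q (G : 'cV[R]_(n1 + n2) -> 'cV[R]_q)
    (x : 'cV[R]_n2 -> 'cV[R]_n1) z :
  differentiable x z -> differentiable G (col_mx (x z) z) ->
  expansion (fun y => G (col_mx (x y) y)) z
    (Jac G (col_mx (x z) z) *m col_mx (Jac x z) 1%:M).
Proof.
move=> dx dG.
have [dg Jg] : differentiable (fun y => col_mx (x y) y) z /\
    Jac (fun y => col_mx (x y) y) z = col_mx (Jac x z) 1%:M.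
  apply: expansion_differentiable => e e0.
  have [d d0 Hd] := differentiable_expansion dx e0; exists d => // h hd.
  have E0 : z + h - z - h = 0 by rewrite (addrC z) addrK subrr.
  rewrite mul_col_mx mul1mx !col_mxB E0.
  apply: le_trans (mx_norm_col_mx _ _) _; rewrite normr0 addr0; exact: Hd.
have dc : differentiable (G \o (fun y => col_mx (x y) y)) z.
  exact: differentiable_comp.
have -> : Jac G (col_mx (x z) z) *m col_mx (Jac x z) 1%:M =
    Jac (G \o (fun y => col_mx (x y) y)) z.
  rewrite -Jg; apply/matrixP => i j; rewrite [RHS]mxE diff_comp// /= !diff_mulmx.
  by rewrite mulmxA -colE [RHS]mxE.
exact: differentiable_expansion.
Qed.

End Selection.

(** * Convex hulls and set-valued fixed points *)

Section Hull.
Variable R : realType.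

Lemma convex_setP (V : lmodType R) (A : set V) :
  @convex_set R V A <->
  forall x y (t : R), 0 <= t <= 1 -> A x -> A y -> A (t *: x + (1 - t) *: y).
Proof.
split=> [cA x y t t01 Ax Ay|cA x y t /set_mem Ax /set_mem Ay]; last first.
  apply/mem_set; apply: (cA x y t%:num) => //.
  by apply/andP; split; [exact: ge0|exact: le1].
have := cA x y (Itv01 (andP t01).1 (andP t01).2) (mem_set Ax) (mem_set Ay).
by move=> /set_mem.
Qed.

Lemma sub_convex_hull (V : lmodType R) (A : set V) : A `<=` convex_hull A.
Proof. exact: sub_gen_smallest. Qed.

Lemma convex_hull_sub (V : lmodType R) (A P : set V) :
  (forall x y (t : R), 0 <= t <= 1 -> P x -> P y -> P (t *: x + (1 - t) *: y)) ->
  A `<=` P -> convex_hull A `<=` P.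
Proof. by move=> cP AP; apply: smallest_sub => //; exact/convex_setP. Qed.

Lemma convex_hull_convex (V : lmodType R) (A : set V) x y (t : R) : 0 <= t <= 1 ->
  convex_hull A x -> convex_hull A y -> convex_hull A (t *: x + (1 - t) *: y).
Proof.
move=> t01 Ax Ay P [cP AP].
have /convex_setP := cP; apply => //; [exact: Ax|exact: Ay].
Qed.

(** Zero weights are skipped, since [x i] is known to lie in [P] only for nonzero ones. A tail of
    total weight 0 is treated apart because it cannot be normalised. *)
Lemma convex_combination (V : lmodType R) (P : set V) (I : eqType) (r : seq I)
    (w : I -> R) (x : I -> V) :
  (forall x y (t : R), 0 <= t <= 1 -> P x -> P y -> P (t *: x + (1 - t) *: y)) ->
  (forall i, 0 <= w i) -> (forall i, w i != 0 -> P (x i)) ->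
  0 < \sum_(i <- r) w i ->
  P ((\sum_(i <- r) w i)^-1 *: \sum_(i <- r) w i *: x i).
Proof.
move=> cP w0 Px; elim: r => [|i r IH]; first by rewrite big_nil ltxx.
rewrite !big_cons; have [wi0|wi0] := eqVneq (w i) 0.
  by rewrite wi0 scale0r !add0r; exact: IH.
have W0 : 0 <= \sum_(j <- r) w j by rewrite sumr_ge0.
move: W0; rewrite le_eqVlt => /predU1P[W0 _|W0 S0].
  have -> : \sum_(j <- r) w j *: x j = 0.
    apply/big1_seq => j /andP[_ jr].
    have : w j <= \sum_(j <- r) w j.
      rewrite (big_rem j)//= lerDl; exact: sumr_ge0.
    by rewrite -W0 => wj; rewrite (_ : w j = 0) ?scale0r//; apply/le_anti; rewrite wj w0.
  by rewrite -W0 !addr0 scalerA mulVf// scale1r; exact: Px.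
set W := \sum_(j <- r) w j in W0 S0 *; set Y := \sum_(j <- r) _.
have -> : (w i + W)^-1 *: (w i *: x i + Y) =
    (w i / (w i + W)) *: x i + (1 - w i / (w i + W)) *: (W^-1 *: Y).
  rewrite scalerDr !scalerA mulrC; congr (_ + _ *: _).
  by field; rewrite !gt_eqF.
apply: cP; [|exact: Px|exact: IH].
by rewrite divr_ge0//= ?(ltW S0)// ler_pdivrMr// mul1r lerDl ltW.
Qed.

(** The hull is the continuous image of the weights supported on [I], a compact face of the standard
    simplex. *)
Lemma convex_hull_compact q n N (M : 'I_N -> 'M[R]_(q, n)) (I : set 'I_N) :
  compact (convex_hull [set M i | i in I]).
Proof.
pose D : set 'rV[R]_N := [set w | [/\ forall i, 0 <= w 0 i, \sum_i w 0 i = 1 &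
  forall i, ~ I i -> w 0 i = 0]].
pose f (w : 'rV[R]_N) := \sum_i w 0 i *: M i.
have entry i : continuous (fun w : 'rV[R]_N => w 0 i) by exact: coord_continuous.
have Dc : compact D.
  apply: bounded_closed_compact.
    exists 1; split => // x x1 w [w0 w1 _].
    apply/mx_norm_leP => [|i j]; first by rewrite ltW// (lt_trans _ x1).
    rewrite (ord1 i) ger0_norm// (le_trans _ (ltW x1))// -w1 (bigD1 j)//= lerDl.
    exact: sumr_ge0.
  have -> : D = \bigcap_i [set w : 'rV[R]_N | 0 <= w 0 i] `&`
      [set w | \sum_i w 0 i = 1] `&` \bigcap_(i in ~` I) [set w | w 0 i = 0].
    apply/seteqP; split => [w [w0 w1 wI]|w [[w0 w1] wI]].
      by split; [split=> // i _; exact: w0|move=> i; exact: wI].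
    by split=> // i; exact: w0.
  apply: closedI; first apply: closedI.
  - apply: closed_bigI => i _.
    by apply: (@closed_comp _ _ (fun w : 'rV[R]_N => w 0 i) [set x | 0 <= x]);
      [move=> ? _; exact: entry|exact: closed_ge].
  - apply: (@closed_comp _ _ (fun w : 'rV[R]_N => \sum_i w 0 i) [set 1]).
      move=> w _; apply: (@lipschitz_continuous _ _ _ _ N%:R) => x y.
      rewrite -sumrB (le_trans (ler_norm_sum _ _ _))//.
      rewrite mulr_natl -[X in _ *+ X]card_ord -sumr_const; apply: ler_sum => i _.
      have -> : x 0 i - y 0 i = (x - y) 0 i by rewrite !mxE.
      exact: mx_norm_entry.
    exact: closed_eq.
  - apply: closed_bigI => i _.
    by apply: (@closed_comp _ _ (fun w : 'rV[R]_N => w 0 i) [set 0]);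
      [move=> ? _; exact: entry|exact: closed_eq].
have fc : continuous f.
  apply: (@lipschitz_continuous _ _ _ _ (\sum_i `|M i|)) => x y.
  rewrite /f -sumrB (le_trans (ler_norm_sum _ _ _))// mulr_suml.
  apply: ler_sum => i _; rewrite -scalerBl normrZ mulrC ler_wpM2l//.
  have -> : x 0 i - y 0 i = (x - y) 0 i by rewrite !mxE.
  exact: mx_norm_entry.
suff -> : convex_hull [set M i | i in I] = f @` D.
  by apply: continuous_compact Dc; apply: continuous_subspaceT.
apply/seteqP; split.
  apply: convex_hull_sub => [_ _ t /andP[t0 t1] [w [w0 w1 wI] <-] [v [v0 v1 vI] <-]|].
    exists (t *: w + (1 - t) *: v); first split.
    - move=> i; rewrite !mxE addr_ge0// mulr_ge0// ?w0 ?v0//; lra.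
    - under eq_bigr do rewrite !mxE.
      by rewrite big_split/= -!mulr_sumr w1 v1 !mulr1 subrKC.
    - by move=> i nI; rewrite !mxE wI// vI// !mulr0 addr0.
    rewrite /f !scaler_sumr -big_split/=; apply: eq_bigr => i _.
    by rewrite !mxE !scalerA [LHS]scalerDl.
  move=> _ [i Ii <-]; exists (delta_mx 0 i).
    split=> [j||j nI].
    - by rewrite mxE; case: (_ && _).
    - rewrite (bigD1 i)//= mxE !eqxx big1 ?addr0// => j ji.
      by rewrite mxE eqxx (negbTE ji).
    - by rewrite mxE eqxx/=; case: eqP => // ji; case: nI; rewrite ji.
  rewrite /f (bigD1 i)//= mxE !eqxx scale1r big1 ?addr0// => j ji.
  by rewrite mxE eqxx (negbTE ji) scale0r.
move=> _ [w [w0 w1 wI] <-].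
have := @convex_combination _ (convex_hull [set M i | i in I]) _
  (index_enum 'I_N) (fun i => w 0 i) M (@convex_hull_convex _ _) w0.
rewrite w1 invr1 scale1r; apply => // i wi; apply: sub_convex_hull; exists i => //.
by apply: contrapT => nI; rewrite wI ?eqxx in wi.
Qed.

End Hull.

Section FixSet.
Variable R : realType.

Lemma frobenius_lipschitz q n (A B : 'M[R]_(q, n)) :
  `|frobenius_norm A - frobenius_norm B| <= (q * n)%:R * `|A - B|.
Proof.
apply: le_trans (frobenius_le_mx_norm _).
have := frobenius_dist B A 0; have := frobenius_dist A B 0.
by rewrite !subr0 frobeniusC ler_norml; lra.
Qed.

(** Heine-Borel for row vectors, carried over to matrices by the continuous map [vec_mx]. *)
Lemma frobenius_ball_compact q n (r : R) :
  compact [set A : 'M[R]_(q, n) | frobenius_norm A <= r].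
Proof.
have lv (v w : 'rV[R]_(q * n)) : `|vec_mx v - vec_mx w| <= 1 * `|v - w|.
  rewrite mul1r -linearB; apply/mx_norm_leP => // i j; rewrite mxE.
  exact: mx_norm_entry.
have -> : [set A : 'M[R]_(q, n) | frobenius_norm A <= r] =
    vec_mx @` [set v | frobenius_norm (vec_mx v : 'M[R]_(q, n)) <= r].
  apply/seteqP; split => [A Ar|_ [v vr <-] //].
  by exists (mxvec A); rewrite /= mxvecK.
apply: continuous_compact.
  by apply: continuous_subspaceT; exact: lipschitz_continuous lv.
apply: bounded_closed_compact.
  exists (`|r|); split; first exact: normr_real.
  move=> x rx v /= vr; apply: le_trans (ltW rx); apply/mx_norm_leP => // i j.
  rewrite (ord1 i) -[v]vec_mxK; case/mxvec_indexP: j => k l; rewrite mxvecE.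
  by rewrite (le_trans (frobenius_entry _ _ _))// (le_trans vr)// ler_norm.
apply: (@closed_comp _ _ (fun v => frobenius_norm (vec_mx v : 'M[R]_(q, n))) [set x | x <= r]);
  last exact: closed_le.
move=> v _; apply: (@lipschitz_continuous _ _ _ _ (q * n)%:R) => x y.
apply: le_trans (frobenius_lipschitz _ _) _; rewrite ler_wpM2l//.
by have := lv x y; rewrite mul1r.
Qed.

(** A kernel vector satisfies [v = A v], hence has norm at most [rho] times itself. The transpose
    appears because [det0P] yields a row vector in the left kernel. *)
Lemma contraction_unit p (A : 'M[R]_p) (rho : R) : rho < 1 ->
  (forall v : 'cV[R]_p, frobenius_norm (A *m v) <= rho * frobenius_norm v) ->
  1%:M - A \in unitmx.
Proof.
move=> r1 HA; rewrite unitmxE unitfE -det_tr; apply/negP => /eqP/eqP/det0P[v v0].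
move=> /(congr1 trmx); rewrite trmx_mul trmxK trmx0 mulmxBl mul1mx => /eqP.
rewrite subr_eq0 => /eqP E.
have := HA v^T; rewrite -E => H.
have N0 := frobenius_ge0 v^T.
have : frobenius_norm v^T = 0 by nra.
by move=> /frobenius_eq0/(congr1 trmx); rewrite trmxK trmx0 => /eqP; rewrite (negbTE v0).
Qed.

Lemma affine_image_rowE p m (J : set 'M[R]_(p, p + m)) (X : set 'M[R]_(p, m)) :
  affine_image J X =
  (fun MY : 'M[R]_(p, p + m) * 'M[R]_(p, m) =>
    lsubmx MY.1 *m MY.2 + rsubmx MY.1) @` (J `*` X).
Proof.
apply/seteqP; split => [W [A [B [Y [JAB XY ->]]]]|W [[M Y] [/= JM XY] <-]].
  by exists (row_mx A B, Y) => //=; rewrite row_mxKl row_mxKr.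
by exists (lsubmx M), (rsubmx M), Y; rewrite hsubmxK.
Qed.

Lemma affine_image_continuous p m :
  continuous (fun MY : 'M[R]_(p, p + m) * 'M[R]_(p, m) =>
    lsubmx MY.1 *m MY.2 + rsubmx MY.1).
Proof.
move=> [M Y] U /nbhs_ballP[e /= e0 eU].
have c0 : 0 < p%:R * (`|M| + 1 + `|Y|) + 1 by rewrite ltr_wpDl// mulr_ge0// !addr_ge0.
set c := _ + 1 in c0.
pose d := Num.min 1 (e / c).
have d0 : 0 < d by rewrite lt_min ltr01 divr_gt0.
apply/nbhs_ballP; exists d => //= -[M' Y'] [/=].
rewrite -!ball_normE /= => MM' YY'; apply: eU; rewrite -ball_normE/=.
have l (A B : 'M[R]_(p, p + m)) : `|lsubmx A - lsubmx B| <= `|A - B|.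
  rewrite -linearB; apply/mx_norm_leP => // i j; rewrite mxE; exact: mx_norm_entry.
have r (A B : 'M[R]_(p, p + m)) : `|rsubmx A - rsubmx B| <= `|A - B|.
  rewrite -linearB; apply/mx_norm_leP => // i j; rewrite mxE; exact: mx_norm_entry.
have -> : lsubmx M *m Y + rsubmx M - (lsubmx M' *m Y' + rsubmx M') =
    lsubmx M' *m (Y - Y') + (lsubmx M - lsubmx M') *m Y + (rsubmx M - rsubmx M').
  rewrite mulmxBr mulmxBl.
  move: (lsubmx M *m Y) (lsubmx M' *m Y) (lsubmx M' *m Y') => u v w.
  by apply/matrixP => i j; rewrite !mxE; ring.
have M1 : `|lsubmx M'| <= `|M| + 1.
  have lM : `|lsubmx M'| <= `|M'|.
    by apply/mx_norm_leP => // i j; rewrite mxE; exact: mx_norm_entry.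
  apply: le_trans lM _; have -> : M' = M - (M - M') by rewrite subKr.
  apply: le_trans (ler_normB _ _) _; rewrite lerD2l ltW// (lt_le_trans MM')//.
  by rewrite ge_min lexx.
have dc : d * c <= e by rewrite -ler_pdivlMr// ge_min lexx orbT.
apply: le_lt_trans (ler_normD _ _) _.
have A3 : `|rsubmx M - rsubmx M'| < d by exact: le_lt_trans (r _ _) MM'.
have A1 : `|lsubmx M' *m (Y - Y')| <= p%:R * (`|M| + 1) * d.
  apply: le_trans (mx_norm_mulmx _ _) _.
  by rewrite ler_pM ?mulr_ge0// ?ler_wpM2l// ltW.
have A2 : `|(lsubmx M - lsubmx M') *m Y| <= p%:R * `|Y| * d.
  apply: le_trans (mx_norm_mulmx _ _) _; rewrite mulrAC ler_wpM2l ?mulr_ge0//.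
  by rewrite ltW// (le_lt_trans (l _ _)).
have A4 := ler_normD (lsubmx M' *m (Y - Y')) ((lsubmx M - lsubmx M') *m Y).
apply: lt_le_trans dc; rewrite /c mulrDr mulr1.
apply: ler_ltD A3; apply: le_trans A4 _; apply: le_trans (lerD A1 A2) _.
by rewrite le_eqVlt; apply/orP; left; apply/eqP; ring.
Qed.

(* Knaster-Tarski: the union of all subsets Z of a ball with Z contained in
   its image is a fixed point; it is closed because its closure is such a Z. *)
Lemma fix_setP p m (J : set 'M[R]_(p, p + m)) (rho : R) :
  compact J -> J !=set0 -> 0 <= rho -> rho < 1 ->
  (forall M, J M -> operator_norm (lsubmx M) <= rho) ->
  [/\ fix_set J !=set0, compact (fix_set J) & fix_set J = affine_image J (fix_set J)].
Proof.
move=> Jc [M0 JM0] r0 r1 Jrho.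
(* [get] satisfies its predicate as soon as some set does, so the goal becomes existence. *)
apply: (@getPex _ [set X | [/\ X !=set0, compact X & X = affine_image J X]]).
have [b Jb] : exists b, forall M, J M -> frobenius_norm (rsubmx M) <= b.
  have [b [_ Hb]] := compact_bounded Jc.
  exists ((p * (p + m))%:R * (b + 1)) => M JM.
  apply: le_trans (frobenius_rsubmx _) (le_trans (frobenius_le_mx_norm _) _).
  by rewrite ler_wpM2l//; apply: Hb => //; rewrite ltrDl.
(* The solution of [rho * r + b = r], so that the ball of radius [r] is mapped into itself. *)
pose r := b / (1 - rho).
have r1' : 0 < 1 - rho by rewrite subr_gt0.
have rE : rho * r + b = r by rewrite /r; field; rewrite gt_eqF.
pose K := [set A : 'M[R]_(p, m) | frobenius_norm A <= r].
have op k M (Y : 'M[R]_(p, k)) : J M -> frobenius_norm (lsubmx M *m Y) <= rho * frobenius_norm Y.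
  by move=> /Jrho H; exact: operator_norm_mulmx.
have GK : affine_image J K `<=` K.
  rewrite affine_image_rowE => _ [[M Y] [/= JM KY] <-] /=; rewrite /K /= -rE.
  apply: le_trans (frobeniusD _ _) _; apply: lerD (Jb _ JM).
  by apply: le_trans (op _ _ _ JM) _; rewrite ler_wpM2l.
have Gmono X Y : X `<=` Y -> affine_image J X `<=` affine_image J Y.
  by move=> XY W [A [B [Z [JAB XZ ->]]]]; exists A, B, Z; split => //; exact: XY.
pose X := \bigcup_(Z in [set Z | Z `<=` K /\ Z `<=` affine_image J Z]) Z.
have maxX Z : Z `<=` K -> Z `<=` affine_image J Z -> Z `<=` X.
  by move=> ZK ZG W ZW; exists Z.
have XK : X `<=` K by move=> W [Z [ZK _] /ZK].
have XG : X `<=` affine_image J X.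
  by move=> W [Z [ZK ZG] /ZG]; apply: Gmono; exact: maxX.
have XE : X = affine_image J X.
  apply/seteqP; split => //; apply: maxX; last exact: Gmono.
  by apply: subset_trans GK; exact: Gmono.
exists X; split => //.
(* The union is nonempty: the fixed point [D] of the single affine map given by [M0] forms a
   singleton contained in its own image. *)
- have Mu := contraction_unit r1 (fun v => op _ _ v JM0).
  pose D := invmx (1%:M - lsubmx M0) *m rsubmx M0.
  have DE : D = lsubmx M0 *m D + rsubmx M0.
    have : (1%:M - lsubmx M0) *m D = rsubmx M0 by rewrite mulKVmx.
    by rewrite mulmxBl mul1mx => <-; rewrite subrKC.
  exists D, [set D] => //; split=> [_ ->|_ ->].
    rewrite /K /= /r ler_pdivlMr// mulrBr mulr1 lerBlDr.
    rewrite (mulrC _ rho) addrC {1}DE; apply: le_trans (frobeniusD _ _) _.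
    by apply: lerD; [exact: op|exact: Jb].
  by exists (lsubmx M0), (rsubmx M0), D; rewrite hsubmxK.
have Kc : closed K.
  by apply: compact_closed; [exact: norm_hausdorff|exact: frobenius_ball_compact].
have cXK : closure X `<=` K by rewrite closureE => W; apply; split.
have cXc : compact (closure X).
  exact: subclosed_compact (@closed_closure _ X) (@frobenius_ball_compact p m r) cXK.
have GcX : closed (affine_image J (closure X)).
  apply: compact_closed; first exact: norm_hausdorff.
  rewrite affine_image_rowE; apply: continuous_compact.
    by apply: continuous_subspaceT; exact: affine_image_continuous.
  exact: compact_setX.
suff -> : X = closure X by [].
apply/seteqP; split; first exact: subset_closure.
apply: maxX => //; rewrite [X in X `<=` _]closureE => W; apply; split => //.
by apply: subset_trans XG _; apply: Gmono; exact: subset_closure.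
Qed.

End FixSet.

(** * Contractions and rates *)

Section Contraction.
Variable R : realType.

Lemma exp_lt (r e : R) : 0 <= r -> r < 1 -> 0 < e -> exists n, r ^+ n < e.
Proof.
move=> r0 r1 e0; have : r ^+ n @[n --> \oo] --> (0 : R).
  by apply: cvg_expr; rewrite ger0_norm.
move=> /cvgrPdist_lt/(_ _ e0)[n _ /(_ n (leqnn n))/=].
by rewrite sub0r normrN ger0_norm ?exprn_ge0// => ?; exists n.
Qed.

Variables (p : nat) (f : 'cV[R]_p -> 'cV[R]_p) (rho : R).
Hypotheses (rho_ge0 : 0 <= rho) (rho_lt1 : rho < 1)
  (f_contr : forall x y, frobenius_norm (f x - f y) <= rho * frobenius_norm (x - y)).

Lemma iter_contraction k x y :
  frobenius_norm (iter k f x - iter k f y) <= rho ^+ k * frobenius_norm (x - y).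
Proof.
elim: k => [|k IH]; first by rewrite expr0 mul1r.
by rewrite !iterS exprS -mulrA; apply: le_trans (f_contr _ _) _; rewrite ler_wpM2l.
Qed.

Lemma contraction_fixpoint : exists x, f x = x.
Proof.
have r1 : 0 < 1 - rho by rewrite subr_gt0.
(* [b] solves [rho * b + a = b] and therefore bounds all Picard iterates started at 0. *)
pose a := frobenius_norm (f 0 - 0); pose b := a / (1 - rho).
have a0 : 0 <= a := frobenius_ge0 _.
have b0 : 0 <= b by rewrite divr_ge0// ltW.
have bE : rho * b + a = b by rewrite /b; field; rewrite gt_eqF.
have ub l : frobenius_norm (iter l f 0 - 0) <= b.
  elim: l => [|l IH]; first by rewrite subrr frobenius0.
  rewrite iterS; apply: le_trans (frobenius_dist (f 0) _ _) _.
  by rewrite -bE; apply: lerD => //; apply: le_trans (f_contr _ _) _; rewrite ler_wpM2l.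
have tail n k : (n <= k)%N -> frobenius_norm (iter k f 0 - iter n f 0) <= rho ^+ n * b.
  move=> nk; rewrite -(subnKC nk) iterD; apply: le_trans (iter_contraction _ _ _) _.
  by rewrite ler_wpM2l// exprn_ge0.
have b1 : 0 < b + 1 by rewrite ltr_wpDl.
have small e : 0 < e -> exists n, rho ^+ n * b < e.
  move=> e0; have e1 : 0 < e / (b + 1) by rewrite divr_gt0.
  have [n ne] := exp_lt rho_ge0 rho_lt1 e1; exists n.
  have nb : rho ^+ n * b <= rho ^+ n * (b + 1).
    by rewrite ler_wpM2l ?exprn_ge0// lerDl.
  by apply: le_lt_trans nb _; rewrite -ltr_pdivlMr.
pose u n := iter n f 0 : 'cV[R]_p.
have : cvg (u @ \oo).
  apply/cauchy_cvgP/cauchy_ballP => e e0.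
  have e20 : 0 < e / 2 by rewrite divr_gt0.
  have [n ne] := small _ e20.
  rewrite near_map2; near=> k l; rewrite -ball_normE/=.
  apply: le_lt_trans (mx_norm_le_frobenius _) _.
  apply: le_lt_trans (frobenius_dist (u n) _ _) _.
  have Hk : frobenius_norm (u k - u n) <= rho ^+ n * b.
    by apply: tail; near: k; exact: nbhs_infty_ge.
  have Hl : frobenius_norm (u l - u n) <= rho ^+ n * b.
    by apply: tail; near: l; exact: nbhs_infty_ge.
  by rewrite (frobeniusC (u n)); lra.
move=> /cvg_ex[x ux]; exists x.
apply/eqP; rewrite -subr_eq0; apply/eqP/frobenius_eq0/le_anti.
rewrite frobenius_ge0 andbT; apply/ler_addgt0Pr => e e0; rewrite add0r.
have c0 : 0 < (p * 1)%:R * 2 + 1 :> R by rewrite ltr_wpDl// mulr_ge0.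
set c := _ + 1 in c0.
have ec0 : 0 < e / c by rewrite divr_gt0.
move/cvgrPdist_lt : ux => /(_ _ ec0)[n _ Hn].
have xn : `|x - u n| < e / c by apply: Hn => /=.
have xn1 : `|x - u n.+1| < e / c by apply: Hn => /=.
have ecE : c * (e / c) = e by rewrite mulrC divfK// gt_eqF.
apply: le_trans (frobenius_dist (u n.+1) _ _) _.
have H1 : frobenius_norm (f x - u n.+1) <= (p * 1)%:R * (e / c).
  apply: le_trans (f_contr x (u n)) _.
  apply: (@le_trans _ _ (frobenius_norm (x - u n))).
    by rewrite ler_piMl ?frobenius_ge0// ltW.
  apply: le_trans (frobenius_le_mx_norm _) _; rewrite ler_wpM2l// ltW//.
have H2 : frobenius_norm (u n.+1 - x) <= (p * 1)%:R * (e / c).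
  rewrite frobeniusC; apply: le_trans (frobenius_le_mx_norm _) _.
  by rewrite ler_wpM2l// ltW//.
move: H1 H2 ecE; rewrite /c; set ec := e / _ => H1 H2 ecE.
by have := lerD H1 H2; have := ltW ec0; rewrite -/ec; lra.
Unshelve. all: by end_near. Qed.

End Contraction.

Section Rate.
Variables (R : realType) (p m : nat).

Lemma gap_le (X Y : set 'M[R]_(p, m)) (c : R) :
  (forall A, X A -> exists2 B, Y B & frobenius_norm (A - B) <= c) ->
  (gap X Y <= c%:E)%E.
Proof.
move=> H; apply: ge_ereal_sup => _ [A /H[B YB ABc] <-].
apply: (@le_trans _ _ (frobenius_norm (A - B))%:E); last by rewrite lee_fin.
by apply: ereal_inf_lbound; exists B.
Qed.

(** Replacing a pair of [J k] by a nearby pair of [Jbar] gives, for [k >= K], the error recursion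
    [e_(k+1) <= rho * e_k + C * (y + 1) * q ^+ k], where [y] bounds [Y]. A bound [C' * q ^+ k]
    propagates once [C' * (q - rho) >= C * (y + 1)]. *)
Lemma affine_rate (J : nat -> set 'M[R]_(p, p + m)) (Jbar : set 'M[R]_(p, p + m))
    (X : nat -> set 'M[R]_(p, m)) (Y : set 'M[R]_(p, m)) (rho q C : R) (K : nat) :
  0 <= rho -> rho < q ->
  (forall k M, J k M -> operator_norm (lsubmx M) <= rho) ->
  (forall k, exists b, forall M, J k M -> frobenius_norm (rsubmx M) <= b) ->
  0 <= C ->
  (forall k M, (K <= k)%N -> J k M ->
     exists2 M', Jbar M' & frobenius_norm (M - M') <= C * q ^+ k) ->
  (exists b, forall A, X 0%N A -> frobenius_norm A <= b) ->
  (forall k, X k.+1 `<=` affine_image (J k) (X k)) ->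
  Y !=set0 -> (exists b, forall B, Y B -> frobenius_norm B <= b) ->
  affine_image Jbar Y `<=` Y ->
  exists C', 0 < C' /\ forall k A, X k A ->
    exists2 B, Y B & frobenius_norm (A - B) <= C' * q ^+ k.
Proof.
move=> r0 rq Jrho Jb C0 HJ X0 XS [B0 YB0] [y Yy] YS.
have q0 : 0 < q := le_lt_trans r0 rq.
have y0 : 0 <= y := le_trans (frobenius_ge0 _) (Yy _ YB0).
have /choice[E HE] : forall k, exists E, 0 <= E /\ forall A, X k A ->
    exists2 B, Y B & frobenius_norm (A - B) <= E.
  suff Xb k : exists b, forall A, X k A -> frobenius_norm A <= b.
    move=> k; have [b Hb] := Xb k.
    exists (`|b| + frobenius_norm B0); split; first by rewrite addr_ge0// frobenius_ge0.
    move=> A XA; exists B0 => //; apply: le_trans (frobeniusD _ _) _.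
    by rewrite frobeniusN lerD2r (le_trans (Hb _ XA))// ler_norm.
  elim: k => [//|k [b IH]]; have [b' Hb'] := Jb k.
  exists (rho * b + b') => A /XS[A1 [A2 [Z [JA XZ ->]]]].
  apply: le_trans (frobeniusD _ _) _; apply: lerD.
    have := Jrho _ _ JA; rewrite row_mxKl => H.
    apply: le_trans (operator_norm_mulmx _ H r0) _; rewrite ler_wpM2l//; exact: IH.
  by have := Hb' _ JA; rewrite row_mxKr.
(* The least constant that the recursion propagates. *)
pose C1 := C * (y + 1) / (q - rho).
have qr0 : 0 < q - rho by rewrite subr_gt0.
have C10 : 0 <= C1 by rewrite divr_ge0 ?(ltW qr0)// mulr_ge0// addr_ge0.
(* Absorbs the indices up to [K], where errors are merely finite. *)
pose S := \sum_(i < K.+1) E i / q ^+ i.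
have Ei0 i : 0 <= E i / q ^+ i by rewrite divr_ge0 ?exprn_ge0 ?(ltW q0)//; have [] := HE i.
have S0 : 0 <= S by exact: sumr_ge0.
pose C' := C1 + S + 1.
have C'0 : 0 < C' by rewrite ltr_wpDl// addr_ge0.
have small k : (k <= K)%N -> E k <= C' * q ^+ k.
  move=> kK; rewrite -ler_pdivrMr ?exprn_gt0//.
  apply: (@le_trans _ _ S); last by rewrite /C'; lra.
  have kK1 : (k < K.+1)%N by [].
  by rewrite /S (bigD1 (Ordinal kK1))//= lerDl sumr_ge0.
exists C'; split => // k; have [kK|Kk] := leqP k K.
  move=> A XA; have [_ /(_ A XA)[B YB AB]] := HE k; exists B => //.
  exact: le_trans AB (small k kK).
rewrite -(subnKC (ltnW Kk)); elim: (k - K)%N => [|j IH] A.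
  rewrite addn0 => XA; have [_ /(_ A XA)[B YB AB]] := HE K; exists B => //.
  exact: le_trans AB (small K (leqnn K)).
rewrite addnS => /XS[A1 [A2 [Z [JA XZ ->]]]].
have [B YB ZB] := IH _ XZ.
have [M' JM' MM'] := HJ _ _ (leq_addr j K) JA.
exists (lsubmx M' *m B + rsubmx M').
  by apply: YS; exists (lsubmx M'), (rsubmx M'), B; rewrite hsubmxK.
set n := (K + j)%N in IH XZ ZB MM' JA *.
have -> : A1 *m Z + A2 - (lsubmx M' *m B + rsubmx M') =
    A1 *m (Z - B) + ((A1 - lsubmx M') *m B + (A2 - rsubmx M')).
  rewrite mulmxBr mulmxBl.
  move: (A1 *m Z) (A1 *m B) (lsubmx M' *m B) => u v w.
  by apply/matrixP => i l; rewrite !mxE; ring.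
apply: le_trans (frobeniusD _ _) _.
have H1 : frobenius_norm (A1 *m (Z - B)) <= rho * (C' * q ^+ n).
  have := Jrho _ _ JA; rewrite row_mxKl => H.
  by apply: le_trans (operator_norm_mulmx _ H r0) _; rewrite ler_wpM2l.
have l1 : frobenius_norm (A1 - lsubmx M') <= C * q ^+ n.
  apply: le_trans MM'; apply: le_trans (frobenius_lsubmx _).
  by rewrite linearB/= row_mxKl.
have l2 : frobenius_norm (A2 - rsubmx M') <= C * q ^+ n.
  apply: le_trans MM'; apply: le_trans (frobenius_rsubmx _).
  by rewrite linearB/= row_mxKr.
have H2 : frobenius_norm ((A1 - lsubmx M') *m B) <= C * q ^+ n * y.
  apply: le_trans (frobenius_mulmx _ _) _.
  by rewrite ler_pM ?frobenius_ge0//; exact: Yy.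
have H3 := frobeniusD ((A1 - lsubmx M') *m B) (A2 - rsubmx M').
apply: (@le_trans _ _ (rho * (C' * q ^+ n) + (C * q ^+ n * y + C * q ^+ n))).
  by apply: lerD H1 _; apply: le_trans H3 (lerD H2 l2).
have C1E : C * (y + 1) = C1 * (q - rho) by rewrite /C1 divfK// gt_eqF.
have C1C' : C1 * (q - rho) <= C' * (q - rho).
  by rewrite ler_pM2r// /C'; lra.
have qn0 : 0 <= q ^+ n by rewrite exprn_ge0// ltW.
have H4 : (rho * C' + C * (y + 1)) * q ^+ n <= C' * q * q ^+ n.
  by rewrite ler_wpM2r// C1E; lra.
by rewrite exprS; lra.
Qed.

End Rate.

(** * Unrolled iterations *)

Section Unrolling.
Variables (R : realType) (p m N : nat) (F : 'cV[R]_(p + m) -> 'cV[R]_p)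
  (s : 'cV[R]_(p + m) -> 'I_N) (Fs : 'I_N -> 'cV[R]_(p + m) -> 'cV[R]_p) (rho L : R).
Hypotheses (F_cont : continuous F) (Fs_diff : forall i z, differentiable (Fs i) z)
  (L_ge0 : 0 <= L)
  (Fs_lip : forall i z z', frobenius_norm (Jac (Fs i) z - Jac (Fs i) z') <=
     L * frobenius_norm (z - z'))
  (F_sel : forall z, F z = Fs (s z) z) (rho_ge0 : 0 <= rho) (rho_lt1 : rho < 1)
  (F_contr : forall x theta (A : 'M[R]_p) (B : 'M[R]_(p, m)),
     selection_jacobian F Fs (col_mx x theta) (row_mx A B) -> operator_norm A <= rho).

Let JF := selection_jacobian F Fs.
Let xbar := fixed_point F.
Let zbar theta := col_mx (xbar theta) theta.

Lemma selection_jacobian_active z i : F z = Fs i z -> JF z (Jac (Fs i) z).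
Proof. by move=> Fi; apply: sub_convex_hull; exists i. Qed.

Lemma selection_jacobian_op z M : JF z M -> operator_norm (lsubmx M) <= rho.
Proof.
by rewrite -[z]vsubmxK -{1}[M]hsubmxK; exact: F_contr.
Qed.

(** Mean value inequality in the direction [(x - x', 0)], on which an active Jacobian acts through
    its [A] block only. *)
Lemma selection_contraction theta x x' :
  frobenius_norm (F (col_mx x theta) - F (col_mx x' theta)) <=
  rho * frobenius_norm (x - x').
Proof.
have -> : col_mx x theta = col_mx x' theta + col_mx (x - x') 0.
  by rewrite add_col_mx subrKC addr0.
apply: (selection_segment F_cont Fs_diff F_sel).
  by rewrite mulr_ge0// frobenius_ge0.
move=> t i _ /selection_jacobian_active/selection_jacobian_op H.
rewrite -[X in X *m _]hsubmxK mul_row_col mulmx0 addr0.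
exact: operator_norm_mulmx.
Qed.

Lemma fixed_pointP theta : F (zbar theta) = xbar theta.
Proof.
apply: (@getPex _ [set x | F (col_mx x theta) = x]).
exact: contraction_fixpoint rho_ge0 rho_lt1 (selection_contraction theta).
Qed.

Lemma fixed_point_dist theta theta' :
  (1 - rho) * frobenius_norm (xbar theta - xbar theta') <=
  frobenius_norm (F (col_mx (xbar theta') theta) - F (col_mx (xbar theta') theta')).
Proof.
have := frobenius_dist (F (col_mx (xbar theta') theta)) (F (zbar theta)) (F (zbar theta')).
rewrite !fixed_pointP.
have := selection_contraction theta (xbar theta) (xbar theta').
by rewrite !fixed_pointP => ? ?; lra.
Qed.

Lemma F_locally_lipschitz z : locally_lipschitz F z.
Proof.
by apply: (selection_locally_lipschitz F_cont Fs_diff F_sel L_ge0); exact: Fs_lip.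
Qed.

(** Two rounds of [fixed_point_dist]. Comparing with [theta] alone gives continuity of the fixed
    point there; continuity then keeps all points in the ball where [F] is Lipschitz, for arbitrary
    nearby pairs. *)
Lemma fixed_point_locally_lipschitz theta : locally_lipschitz xbar theta.
Proof.
have [M [d [M0 d0 HF]]] := F_locally_lipschitz (zbar theta).
have r1 : 0 < 1 - rho by rewrite subr_gt0.
pose K := (p * 1)%:R * M / (1 - rho).
have K0 : 0 <= K by rewrite divr_ge0 ?mulr_ge0// ltW.
have step y y' : `|col_mx (xbar y') y - zbar theta| < d ->
    `|zbar y' - zbar theta| < d -> `|xbar y - xbar y'| <= K * `|y - y'|.
  move=> h1 h2; rewrite /K mulrAC ler_pdivlMr// mulrC.
  apply: le_trans (ler_wpM2l (ltW r1) (mx_norm_le_frobenius _)) _.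
  apply: le_trans (fixed_point_dist y y') _.
  apply: le_trans (frobenius_le_mx_norm _) _; rewrite -mulrA ler_wpM2l//.
  apply: le_trans (HF _ _ h1 h2) _; rewrite ler_wpM2l// col_mxB subrr.
  by apply: le_trans (mx_norm_col_mx _ _) _; rewrite normr0 add0r.
clearbody K.
have K1 : 0 < 2 * (K + 1) by rewrite mulr_gt0// ltr_wpDl.
have close0 y : `|y - theta| < d -> `|xbar y - xbar theta| <= K * `|y - theta|.
  move=> yd; apply: step; last by rewrite subrr normr0.
  rewrite col_mxB subrr; apply: le_lt_trans (mx_norm_col_mx _ _) _.
  by rewrite normr0 add0r.
exists K, (Num.min (d / 2) (d / (2 * (K + 1)))); split => //.
  by rewrite lt_min !divr_gt0.
have close y : `|y - theta| < Num.min (d / 2) (d / (2 * (K + 1))) ->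
    `|y - theta| < d / 2 /\ `|xbar y - xbar theta| < d / 2.
  rewrite lt_min (ltr_pdivlMr _ _ K1) => /andP[y1 y2]; split => //.
  have yd : `|y - theta| < d by lra.
  by have := close0 y yd; have := normr_ge0 (y - theta) => ? ?; lra.
move=> y y' /close[y1 y2] /close[y'1 y'2]; apply: step; rewrite col_mxB.
  by apply: le_lt_trans (mx_norm_col_mx _ _) _; lra.
by apply: le_lt_trans (mx_norm_col_mx _ _) _; lra.
Qed.

Lemma iterate_dist x0 k theta :
  frobenius_norm (iterate F x0 k theta - xbar theta) <=
  rho ^+ k * frobenius_norm (x0 theta - xbar theta).
Proof.
elim: k => [|k IH] /=; first by rewrite expr0 mul1r.
rewrite -{1}(fixed_pointP theta); apply: le_trans (selection_contraction _ _ _) _.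
by rewrite exprS -mulrA ler_wpM2l.
Qed.

(** Along [S] the chain rule for the branch [Fs i] gives the expansion, which nonporosity extends to
    all directions. *)
Lemma step_differentiable (x : 'cV[R]_m -> 'cV[R]_p) theta i :
  let S := [set y | F (col_mx (x y) y) = Fs i (col_mx (x y) y)] in
  locally_lipschitz x theta -> differentiable x theta -> S theta ->
  nonporous S theta ->
  differentiable (fun y => F (col_mx (x y) y)) theta /\
  Jac (fun y => F (col_mx (x y) y)) theta =
    Jac (Fs i) (col_mx (x theta) theta) *m col_mx (Jac x theta) 1%:M.
Proof.
move=> S lx dx Sth npS; apply: expansion_differentiable.
apply: nonporous_expansion npS _.
  exact: locally_lipschitz_graph lx (F_locally_lipschitz _).
move=> e e0; have [d d0 Hd] := expansion_graph dx (Fs_diff i _) e0.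
exists d => // y Sy yd; have := Hd _ yd.
by rewrite subrKC /= -Sy -Sth.
Qed.

(** Implicit differentiation along [S]. With [M = [A, B]] and [D] the solution of [D = A D + B], the
    error [u] of the linear approximation satisfies [u = A u + o(|h|)], so
    [(1 - rho) * |u| = o(|h|)]. *)
Lemma fixed_point_differentiable theta i :
  let S := [set y | F (zbar y) = Fs i (zbar y)] in
  let M := Jac (Fs i) (zbar theta) in
  S theta -> nonporous S theta ->
  differentiable xbar theta /\
  Jac xbar theta = lsubmx M *m Jac xbar theta + rsubmx M.
Proof.
move=> S M Sth npS.
have Mop k (Y : 'M[R]_(p, k)) :
    frobenius_norm (lsubmx M *m Y) <= rho * frobenius_norm Y.
  apply: operator_norm_mulmx => //; apply: selection_jacobian_op.
  exact: selection_jacobian_active.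
pose D := invmx (1%:M - lsubmx M) *m rsubmx M.
have Mu := contraction_unit rho_lt1 (Mop 1%N).
have DE : D = lsubmx M *m D + rsubmx M.
  have : (1%:M - lsubmx M) *m D = rsubmx M by rewrite mulKVmx.
  by rewrite mulmxBl mul1mx => <-; rewrite subrKC.
suff /expansion_differentiable[dx ->] : expansion xbar theta D by [].
have lx := fixed_point_locally_lipschitz theta.
apply: (nonporous_expansion lx npS) => e e0.
have [K [d1 [K0 d10 HK]]] := lx.
have r1 : 0 < 1 - rho by rewrite subr_gt0.
have c0 : 0 < (p * 1)%:R * (K + 1) + 1 by rewrite ltr_wpDl// mulr_ge0// addr_ge0.
set c := _ + 1 in c0.
(* The branch remainder is at most [p * e' * (K + 1) * |h|] in Frobenius norm; this [e'] keeps it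
   below [(1 - rho) * e * |h|]. *)
have e'0 : 0 < (1 - rho) * e / c by rewrite divr_gt0// mulr_gt0.
have e'E : c * ((1 - rho) * e / c) = (1 - rho) * e by rewrite mulrC divfK// gt_eqF.
set e' := _ / c in e'0 e'E.
have [d2 d20 H2] := differentiable_expansion (Fs_diff i (zbar theta)) e'0.
have K1 : 0 < K + 1 by rewrite ltr_wpDl.
exists (Num.min d1 (d2 / (K + 1))); first by rewrite lt_min d10 divr_gt0.
move=> y Sy; rewrite lt_min ltr_pdivlMr// => /andP[y1 y2].
have xy : `|xbar y - xbar theta| <= K * `|y - theta|.
  by apply: HK => //; rewrite subrr normr0.
have zy : `|zbar y - zbar theta| <= (K + 1) * `|y - theta|.
  rewrite col_mxB mulrDl mul1r; apply: le_trans (mx_norm_col_mx _ _) _.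
  by rewrite lerD2r.
have zd : `|zbar y - zbar theta| < d2 by apply: le_lt_trans zy _; rewrite mulrC.
have := H2 _ zd; rewrite subrKC -Sy -Sth !fixed_pointP.
set Delta := xbar y - xbar theta; set h := y - theta => Hr.
have uE : Delta - D *m h =
    lsubmx M *m (Delta - D *m h) + (Delta - M *m (zbar y - zbar theta)).
  have Dh : D *m h = lsubmx M *m (D *m h) + rsubmx M *m h.
    by rewrite mulmxA -mulmxDl -DE.
  rewrite -{2}[M]hsubmxK col_mxB -/Delta -/h mul_row_col (mulmxBr (lsubmx M)) {1}Dh.
  move: (lsubmx M *m Delta) (lsubmx M *m (D *m h)) (rsubmx M *m h) => u v w.
  by apply/matrixP => a b; rewrite !mxE; ring.
have H3 := frobeniusD (lsubmx M *m (Delta - D *m h)) (Delta - M *m (zbar y - zbar theta)).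
rewrite -uE in H3.
have H4 := Mop 1%N (Delta - D *m h).
have H5 : frobenius_norm (Delta - M *m (zbar y - zbar theta)) <=
    (p * 1)%:R * (e' * ((K + 1) * `|h|)).
  apply: le_trans (frobenius_le_mx_norm _) _; rewrite ler_wpM2l//.
  by apply: le_trans Hr _; rewrite ler_wpM2l// ltW.
apply: le_trans (mx_norm_le_frobenius _) _.
rewrite -(ler_pM2l r1).
have H6 : (p * 1)%:R * (e' * ((K + 1) * `|h|)) <= c * e' * `|h|.
  have -> : (p * 1)%:R * (e' * ((K + 1) * `|h|)) = (p * 1)%:R * (K + 1) * (e' * `|h|).
    by ring.
  by rewrite -[X in _ <= X]mulrA ler_wpM2r ?lerDl// mulr_ge0// ltW.
rewrite e'E in H6; lra.
Qed.

(** Branches active near [z] are active at [z], and each generator moves by at most [L] times the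
    distance. Lying within that distance of the convex set [JF z] is a convex condition, so it
    passes to the hull. *)
Lemma selection_jacobian_close z : exists2 d, 0 < d & forall y, `|y - z| < d ->
  forall M, JF y M ->
  exists2 M', JF z M' & frobenius_norm (M - M') <= L * frobenius_norm (y - z).
Proof.
have [d d0 Hd] := active_near F_cont Fs_diff z.
exists d => // y yd.
apply: convex_hull_sub => [A B t /andP[t0 t1] [A' JA AA'] [B' JB BB']|_ [i Fi <-]].
  exists (t *: A' + (1 - t) *: B').
    by apply: convex_hull_convex => //; rewrite t0 t1.
  have -> : t *: A + (1 - t) *: B - (t *: A' + (1 - t) *: B') =
      t *: (A - A') + (1 - t) *: (B - B').
    by apply/matrixP => k l; rewrite !mxE; ring.
  apply: le_trans (frobeniusD _ _) _; rewrite !frobeniusZ ger0_norm//.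
  have t1' : 0 <= 1 - t by rewrite subr_ge0.
  rewrite ger0_norm//.
  by have := lerD (ler_wpM2l t0 AA') (ler_wpM2l t1' BB'); lra.
exists (Jac (Fs i) z); last exact: Fs_lip.
by apply: selection_jacobian_active; exact: Hd yd Fi.
Qed.

Lemma selection_jacobian_bounded z : exists b, forall M, JF z M ->
  frobenius_norm (rsubmx M) <= b.
Proof.
exists (\sum_i frobenius_norm (Jac (Fs i) z)) => M JM.
apply: le_trans (frobenius_rsubmx _) _; move: M JM.
apply: convex_hull_sub => [A B t /andP[t0 t1] HA HB|_ [i _ <-]].
  apply: le_trans (frobeniusD _ _) _; rewrite !frobeniusZ ger0_norm//.
  have t1' : 0 <= 1 - t by rewrite subr_ge0.
  rewrite ger0_norm//.
  by have := lerD (ler_wpM2l t0 HA) (ler_wpM2l t1' HB); lra.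
by rewrite (bigD1 i)//= lerDl sumr_ge0// => k _; exact: frobenius_ge0.
Qed.

(** Stated with inclusions for arbitrary sequences of sets, so as to serve both the iterated
    conservative Jacobians and the singletons of classical Jacobians. *)
Lemma unrolled_rate x0 theta (X : nat -> set 'M[R]_(p, m)) (Y : set 'M[R]_(p, m)) q :
  rho < q ->
  (exists b, forall A, X 0%N A -> frobenius_norm A <= b) ->
  (forall k, X k.+1 `<=`
     affine_image (JF (col_mx (iterate F x0 k theta) theta)) (X k)) ->
  Y !=set0 -> (exists b, forall B, Y B -> frobenius_norm B <= b) ->
  affine_image (JF (zbar theta)) Y `<=` Y ->
  exists C, 0 < C /\ forall k A, X k A ->
    exists2 B, Y B & frobenius_norm (A - B) <= C * q ^+ k.
Proof.
move=> rq X0 XS Y0 Yb YS.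
pose a := frobenius_norm (x0 theta - xbar theta).
have a0 : 0 <= a := frobenius_ge0 _.
have [d d0 Hd] := selection_jacobian_close (zbar theta).
have a1 : 0 < a + 1 by rewrite ltr_wpDl.
have da0 : 0 < d / (a + 1) by rewrite divr_gt0.
(* From index [K] on, the iterates stay in the ball where [selection_jacobian_close] applies;
   [a + 1] avoids a division by 0. *)
have [K] := exp_lt rho_ge0 rho_lt1 da0; rewrite ltr_pdivlMr// => HK.
have zE k : col_mx (iterate F x0 k theta) theta - zbar theta =
    col_mx (iterate F x0 k theta - xbar theta) 0 by rewrite col_mxB subrr.
apply: (@affine_rate R p m _ (JF (zbar theta)) X Y rho q (L * a) K) XS _ _ _ => //.
- by move=> k M; exact: selection_jacobian_op.
- by move=> k; exact: selection_jacobian_bounded.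
- by rewrite mulr_ge0.
- move=> k M Kk JM.
  have zk : `|col_mx (iterate F x0 k theta) theta - zbar theta| < d.
    apply: le_lt_trans (mx_norm_le_frobenius _) _; rewrite zE frobenius_col_mx0.
    apply: le_lt_trans (iterate_dist x0 k theta) (le_lt_trans _ HK).
    rewrite -/a; apply: ler_pM => //; first exact: exprn_ge0.
      by rewrite ler_wiXn2l// ltW.
    by rewrite lerDl.
  have [M' JM' MM'] := Hd _ zk M JM; exists M' => //.
  apply: le_trans MM' _; rewrite zE frobenius_col_mx0 -mulrA ler_wpM2l//.
  apply: le_trans (iterate_dist x0 k theta) _; rewrite mulrC ler_wpM2l//.
  by rewrite lerXn2r ?nnegrE// ?(ltW rq)// (le_trans rho_ge0 (ltW rq)).
Qed.

End Unrolling.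

(** * Assembly: the gap estimate and the almost-everywhere rate *)

Section Lipschitz.
Variables (R : realType) (V W : normedModType R).

(** [lipschitz] concerns all sufficiently large constants; [|M| + 1] is one of them and is
    nonnegative. *)
Lemma lipschitz_bound (f : V -> W) : lipschitz f ->
  exists2 M : R, 0 <= M & forall x y, `|f x - f y| <= M * `|x - y|.
Proof.
move=> [M [_ HM]]; exists (`|M| + 1); first by rewrite addr_ge0.
move=> x y; have M1 : M < `|M| + 1 by rewrite ltr_pwDr// ler_norm.
exact: (HM _ M1 (x, y)).
Qed.

End Lipschitz.

Theorem corollary3 (R : realType) (p m N : nat)
    (F : 'cV[R]_(p + m) -> 'cV[R]_p)
    (s : 'cV[R]_(p + m) -> 'I_N)
    (Fs : 'I_N -> 'cV[R]_(p + m) -> 'cV[R]_p)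
    (rho : R)
    (x0 : 'cV[R]_m -> 'cV[R]_p)
    (J0 : 'cV[R]_m -> set 'M[R]_(p, m))
    (F_continuous : continuous F)
    (F_semialgebraic : semialgebraic_map F)
    (F_selection : lipschitz_gradient_selection F s Fs)
    (rho_ge0 : 0 <= rho) (rho_lt1 : rho < 1)
    (F_contraction : forall (x : 'cV[R]_p) (theta : 'cV[R]_m)
       (A : 'M[R]_p) (B : 'M[R]_(p, m)),
       selection_jacobian F Fs (col_mx x theta) (row_mx A B) ->
       operator_norm A <= rho)
    (x0_lipschitz : lipschitz x0)
    (x0_conservative : conservative_jacobian x0 J0) :
  let JF := selection_jacobian F Fs in
  let x := iterate F x0 in
  let Jx := iterate_jacobian F JF x0 J0 in
  let xbar := fixed_point F in
  let Jpb := fun theta : 'cV[R]_m => fix_set (JF (col_mx (xbar theta) theta)) in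
  (forall (theta : 'cV[R]_m) (e : R), 0 < e ->
     exists C : R, 0 < C /\ forall k : nat,
       (gap (Jx k theta) (Jpb theta) <= (C * (Num.sqrt rho + e) ^+ k)%:E)%E) /\
  almost_all (fun theta : 'cV[R]_m =>
    [/\ (forall k : nat, differentiable (x k) theta),
        differentiable xbar theta &
        exists C r : R, [/\ 0 < C, 0 < r, r < 1 &
          forall k : nat,
            frobenius_norm (Jac (x k) theta - Jac xbar theta) <= C * r ^+ k]]).
Proof.
have [_ [L [L_ge0 HL]] F_sel] := F_selection.
have Fs_diff i z : differentiable (Fs i) z by have [_ + _] := HL i.
have Fs_lip i z z' : frobenius_norm (Jac (Fs i) z - Jac (Fs i) z') <=
    L * frobenius_norm (z - z') by have [_ _ +] := HL i.
move=> JF x Jx xbar Jpb.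
have rate := unrolled_rate F_continuous Fs_diff L_ge0 Fs_lip F_sel rho_ge0 rho_lt1
  F_contraction.
split.
  move=> theta e e0; pose zbar := col_mx (xbar theta) theta.
  have [Jpb0 Jpbc JpbE] : [/\ Jpb theta !=set0, compact (Jpb theta) &
      Jpb theta = affine_image (JF zbar) (Jpb theta)].
    apply: (@fix_setP R p m (JF zbar) rho) => //.
    - exact: convex_hull_compact.
    - exists (Jac (Fs (s zbar)) zbar); exact: selection_jacobian_active (F_sel _).
    - by move=> M; exact: selection_jacobian_op F_contraction _ _.
  (* [rho <= Num.sqrt rho] because [rho <= 1], so the claimed ratio is an admissible [q]. *)
  have rq : rho < Num.sqrt rho + e.
    have s1 : Num.sqrt rho <= 1 by rewrite -sqrtr1 ler_wsqrtr// ltW.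
    have : Num.sqrt rho ^+ 2 <= Num.sqrt rho.
      by rewrite expr2 ler_piMl ?sqrtr_ge0.
    by rewrite sqr_sqrtr//; lra.
  have J0b : exists b, forall A, Jx 0%N theta A -> frobenius_norm A <= b.
    have [_ Jb _ _] := x0_conservative; have [b /nbhs_singleton Hb] := Jb theta.
    by exists b.
  have Jpbb : exists b, forall A, Jpb theta A -> frobenius_norm A <= b.
    have [b [_ Hb]] := compact_bounded Jpbc.
    exists ((p * m)%:R * (b + 1)) => M JM.
    apply: le_trans (frobenius_le_mx_norm _) _.
    by rewrite ler_wpM2l//; apply: Hb => //; rewrite ltrDl.
  have JpbS : affine_image (JF zbar) (Jpb theta) `<=` Jpb theta by rewrite -JpbE.
  have [C [C0 HC]] := rate x0 theta (Jx ^~ theta) (Jpb theta) _ rq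
    J0b (fun k => @subset_refl _ _) Jpb0 Jpbb JpbS.
  exists C; split => // k; apply: gap_le; exact: HC.
have [M M0 x0_lip] := lipschitz_bound x0_lipschitz.
have ax0 := lipschitz_differentiable_almost_all M0 x0_lip x0_conservative.
pose S k i := [set y | F (col_mx (x k y) y) = Fs i (col_mx (x k y) y)].
pose Sbar i := [set y | F (col_mx (xbar y) y) = Fs i (col_mx (xbar y) y)].
(* Countably many coincidence sets occur, one for each iteration and branch, so a single null set
   handles all of them. *)
have aS := almost_all_forall (fun ki : nat * 'I_N => nonporous_almost_all (S ki.1 ki.2)).
have aSbar := almost_all_forall (fun i => nonporous_almost_all (Sbar i)).
apply: almost_allW (almost_allI ax0 (almost_allI aS aSbar)) => theta [dx0 [npS npSbar]].
have lip0 : locally_lipschitz x0 theta.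
  by exists M, 1; split => // y y' _ _; exact: x0_lip.
have loc k : locally_lipschitz (x k) theta /\ differentiable (x k) theta.
  elim: k => [|k [lx dx]]; first by [].
  split; first exact: locally_lipschitz_graph lx
    (F_locally_lipschitz F_continuous Fs_diff L_ge0 Fs_lip F_sel _).
  have Sk : S k (s (col_mx (x k theta) theta)) theta by exact: F_sel.
  by have [] := step_differentiable F_continuous Fs_diff L_ge0 Fs_lip F_sel lx dx Sk
    (npS (k, s (col_mx (x k theta) theta)) Sk).
(* Stated for every active branch, not just the selected one, because all of them generate the hull
   at the limit. *)
have barE i : Sbar i theta -> differentiable xbar theta /\
    let Mi := Jac (Fs i) (col_mx (xbar theta) theta) in
    Jac xbar theta = lsubmx Mi *m Jac xbar theta + rsubmx Mi.
  move=> Si; exact: (fixed_point_differentiable F_continuous Fs_diff L_ge0 Fs_lip F_sel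
    rho_ge0 rho_lt1 F_contraction Si (npSbar i Si)).
have [dxbar _] := barE _ (F_sel (col_mx (xbar theta) theta)).
split => //; first by move=> k; have [] := loc k.
(* Any ratio strictly between [rho] and 1 gives a linear rate; the midpoint is taken. *)
have rq : rho < (1 + rho) / 2 by lra.
pose X k : set 'M[R]_(p, m) := [set Jac (x k) theta].
pose Y : set 'M[R]_(p, m) := [set Jac xbar theta].
have Xb : exists b, forall A, X 0%N A -> frobenius_norm A <= b.
  by exists (frobenius_norm (Jac x0 theta)) => _ ->.
have XS k : X k.+1 `<=`
    affine_image (JF (col_mx (iterate F x0 k theta) theta)) (X k).
  move=> _ ->; have [lx dx] := loc k.
  set z := col_mx (x k theta) theta.
  have Sk : S k (s z) theta by exact: F_sel.
  have [_ JE] := step_differentiable F_continuous Fs_diff L_ge0 Fs_lip F_sel lx dx Sk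
    (npS (k, s z) Sk).
  exists (lsubmx (Jac (Fs (s z)) z)), (rsubmx (Jac (Fs (s z)) z)), (Jac (x k) theta).
  split => //; first by rewrite hsubmxK; exact: selection_jacobian_active (F_sel _).
  rewrite -[LHS]/(Jac (fun y => F (col_mx (x k y) y)) theta) JE -/z.
  by rewrite -{1}[Jac (Fs (s z)) z]hsubmxK mul_row_col mulmx1.
have Y0 : Y !=set0.
  by exists (Jac xbar theta).
have Yb : exists b, forall B, Y B -> frobenius_norm B <= b.
  by exists (frobenius_norm (Jac xbar theta)) => _ ->.
have YS : affine_image (JF (col_mx (xbar theta) theta)) Y `<=` Y.
  move=> _ [A [B [_ [JAB -> ->]]]].
  (* Fixing [Jac xbar theta] is an affine condition on [[A, B]]. It holds for all active branches,
     hence on their hull, and the singleton [Y] is invariant. *)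
  have H : JF (col_mx (xbar theta) theta) `<=`
      [set M | lsubmx M *m Jac xbar theta + rsubmx M = Jac xbar theta].
    apply: convex_hull_sub => [M1 M2 t _ /= H1 H2|_ [i Fi <-] /=].
      rewrite !linearD/= !linearZ/= mulmxDl -!scalemxAl.
      rewrite addrACA -!scalerDr H1 H2 -scalerDl subrKC scale1r //.
    by have [_ /esym] := barE i Fi.
  by have := H _ JAB; rewrite /= row_mxKl row_mxKr.
have [C [C0 HC]] := rate x0 theta X Y _ rq Xb XS Y0 Yb YS.
exists C, ((1 + rho) / 2); split => //; [lra|lra|].
by move=> k; have [_ -> ] := HC k _ erefl.
Qed.
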